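(* Let $T>0$, $\Omega=[x_L,x_R]\subset\mathbb{R}$ a bounded interval, $K=[0,T]\times\Omega$, $\Phi$ a smooth potential, and $\lambda_1,\lambda_2>0$ fixed. Let $G:K\to\mathbb{R}$ be a given fixed function (the Stage 1 output $\partial_x m_2^{\mathrm{NN},\mathrm{stage1}}$). Assume that $(m_0,m_1)$ solves the moment system $$\partial_t m_0+\partial_x m_1=0,\qquad \partial_t m_1+G=-m_0\,\partial_x\Phi\qquad\text{on }K,$$ with initial profiles $(m_0(0,\cdot),m_1(0,\cdot))$ and periodic boundary conditions $m_k(t,x_L)=m_k(t,x_R)$ for $t\in[0,T]$, $k=0,1$, and that $m_0,m_1\in C^1(K)$. Assume that the activation function $\sigma\in C^1(\mathbb{R})$ is non-polynomial. Then, for both $k=0$ and $k=1$, there exist numbers of nodes, weights and biases $\{n_{k,[j]},w_{k,[j]},b_{k,[j]}\}_{j=1}^\infty$ such that the corresponding neural networks $(m_k)_j(t,x)=m_k^{\mathrm{NN}}(t,x;n_{k,[j]},w_{k,[j]},b_{k,[j]})$ with activation $\sigma$ satisfy $$\mathrm{Loss}_{\mathrm{stage2}}\big((m_0)_j,(m_1)_j\big)\to 0\quad\text{as } j\to\infty .$$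
   Context: Neural networks: for $k=0,1$, $m_k^{\mathrm{NN}}(t,x;n,w,b)$ denotes a two-layer neural network with $n$ nodes and activation $\sigma$, $$m_k^{\mathrm{NN}}(t,x)=\sum_{i=1}^{n} w^{k,(2)}_{1i}\,\sigma\big((w^{k,(1)}_{i1},w^{k,(1)}_{i2})\cdot(t,x)+b^{k,(1)}_i\big)+b^{k,(2)}_i ,$$ where the $w$'s are real weights and the $b$'s are real biases (collected into $w$ and $b$). Loss: for a pair $(p_0,p_1)$ of $C^1$ functions on $K$ (approximating $(m_0,m_1)$), $$\mathrm{Loss}_{\mathrm{stage2}}(p_0,p_1)=\mathrm{Loss}_{\mathrm{GE}}+\lambda_1\mathrm{Loss}_{\mathrm{BC}}+\lambda_2\mathrm{Loss}_{\mathrm{IC}},$$ where $$\mathrm{Loss}_{\mathrm{GE}}=\int_0^T\!\!\int_\Omega |\partial_t p_0+\partial_x p_1|^2\,dx\,dt+\int_0^T\!\!\int_\Omega |\partial_t p_1+G+p_0\,\partial_x\Phi|^2\,dx\,dt,$$ $$\mathrm{Loss}_{\mathrm{BC}}=\int_0^T |p_0(s,x_L)-p_0(s,x_R)|^2\,ds+\int_0^T |p_1(s,x_L)-p_1(s,x_R)|^2\,ds,$$ $$\mathrm{Loss}_{\mathrm{IC}}=\int_\Omega |p_0(0,x)-m_0(0,x)|^2\,dx+\int_\Omega |p_1(0,x)-m_1(0,x)|^2\,dx .$$ In the paper the loss is written $\mathrm{Loss}_{\mathrm{stage2}}(\theta)$, with $\theta$ the network parameters. *)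

(* Defs.v *)
From HB Require Import structures.
From mathcomp Require Import all_boot all_order all_algebra.
From mathcomp Require Import all_classical all_reals all_analysis.
Set Implicit Arguments.
Unset Strict Implicit.
Unset Printing Implicit Defensive.
Import Order.TTheory GRing.Theory Num.Theory.
Import numFieldNormedType.Exports.
Local Open Scope classical_set_scope.
Local Open Scope ring_scope.

Section Derivatives.
Context {R : realType}.

(* Difference quotients whose increment keeps the point inside [A]: on a closed
   interval they give the usual derivative in the interior and the one-sided
   derivative at the endpoints, and ignore the values of [g] outside [A]. *)
Definition derivable_within (A : set R) (g : R -> R) (x : R) : Prop :=
  cvg ((fun h => h^-1 * (g (x + h) - g x)) @ within [set h | A (x + h)] 0^').

Definition derive_within (A : set R) (g : R -> R) (x : R) : R :=
  lim ((fun h => h^-1 * (g (x + h) - g x)) @ within [set h | A (x + h)] 0^').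

Definition rect (T xL xR : R) : set (R * R) := `[0, T] `*` `[xL, xR].

Definition pdt (T : R) (f : R * R -> R) (z : R * R) : R :=
  derive_within `[0, T] (fun s => f (s, z.2)) z.1.

Definition pdx (xL xR : R) (f : R * R -> R) (z : R * R) : R :=
  derive_within `[xL, xR] (fun y => f (z.1, y)) z.2.

Fixpoint Cn_rect (n : nat) (T xL xR : R) (f : R * R -> R) : Prop :=
  {within rect T xL xR, continuous f} /\
  if n is k.+1 then
    [/\ forall z, rect T xL xR z ->
          derivable_within `[0, T] (fun s => f (s, z.2)) z.1 /\
          derivable_within `[xL, xR] (fun y => f (z.1, y)) z.2,
        Cn_rect k T xL xR (pdt T f) &
        Cn_rect k T xL xR (pdx xL xR f)]
  else True.

Definition smooth_rect (T xL xR : R) (f : R * R -> R) : Prop :=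
  forall n, Cn_rect n T xL xR f.

Definition C1_real (s : R -> R) : Prop :=
  (forall x, derivable s x 1) /\ continuous (derive1 s).

Definition is_polynomial (s : R -> R) : Prop :=
  exists p : {poly R}, forall x, s x = p.[x].

End Derivatives.

Section Network.
Context {R : realType}.

Record nn_params := NNParams {
  nn_nodes : nat;
  nn_nodes_gt0 : (0 < nn_nodes)%N;
  nn_w1 : 'M[R]_(nn_nodes, 2);
  nn_b1 : 'cV[R]_nn_nodes;
  nn_w2 : 'rV[R]_nn_nodes;
  nn_b2 : 'cV[R]_nn_nodes }.

(* The outer biases carry the node index and are summed with the nodes. *)
Definition nn (s : R -> R) (q : nn_params) (z : R * R) : R :=
  \sum_(i < nn_nodes q)
    (nn_w2 q 0 i *
       s (nn_w1 q i 0 * z.1 + nn_w1 q i 1 * z.2 + nn_b1 q i 0) + nn_b2 q i 0).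

End Network.
Arguments nn_params R : clear implicits.

Section Loss.
Context {R : realType}.
Local Open Scope ereal_scope.
Let mu := @lebesgue_measure R.

(* The losses are extended-real valued, so a non-integrable residual has
   infinite loss. *)
Definition loss_GE (T xL xR : R) (Phi G p0 p1 : R * R -> R) : \bar R :=
  (\int[mu]_(t in `[0%R, T]) \int[mu]_(x in `[xL, xR])
    (`|pdt T p0 (t, x) + pdx xL xR p1 (t, x)| ^+ 2)%R%:E)
  + (\int[mu]_(t in `[0%R, T]) \int[mu]_(x in `[xL, xR])
    (`|pdt T p1 (t, x) + G (t, x) + p0 (t, x) * pdx xL xR Phi (t, x)| ^+ 2)%R%:E).

Definition loss_BC (T xL xR : R) (p0 p1 : R * R -> R) : \bar R :=
  (\int[mu]_(s in `[0%R, T]) (`|p0 (s, xL) - p0 (s, xR)| ^+ 2)%R%:E)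
  + (\int[mu]_(s in `[0%R, T]) (`|p1 (s, xL) - p1 (s, xR)| ^+ 2)%R%:E).

Definition loss_IC (xL xR : R) (m0 m1 p0 p1 : R * R -> R) : \bar R :=
  (\int[mu]_(x in `[xL, xR]) (`|p0 (0, x) - m0 (0, x)| ^+ 2)%R%:E)
  + (\int[mu]_(x in `[xL, xR]) (`|p1 (0, x) - m1 (0, x)| ^+ 2)%R%:E).

Definition loss_stage2 (T xL xR lambda1 lambda2 : R)
    (Phi G m0 m1 p0 p1 : R * R -> R) : \bar R :=
  loss_GE T xL xR Phi G p0 p1 + lambda1%:E * loss_BC T xL xR p0 p1
  + lambda2%:E * loss_IC xL xR m0 m1 p0 p1.

End Loss.

Definition moment_system {R : realType} (T xL xR : R)
    (Phi G m0 m1 : R * R -> R) : Prop :=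
  forall z, rect T xL xR z ->
    pdt T m0 z + pdx xL xR m1 z = 0 /\
    pdt T m1 z + G z = - m0 z * pdx xL xR Phi z.

Definition periodic_bc {R : realType} (T xL xR : R) (m : R * R -> R) : Prop :=
  forall t, t \in `[0, T] -> m (t, xL) = m (t, xR).

(* Main.v *)
(* All residuals in the loss are bounded, uniformly on K, by the C^1(K) distance of the
   networks to (m_0, m_1), so it suffices to prove that the networks are C^1-dense.

   Call a pair (s, s') a profile if the jets of all ridge functions s(at + bx + c) are
   uniform limits on K of jets of networks. Profiles are closed under affine changes of
   variable, limits and Riemann means, hence under S |-> S(. + h) - S when S' = s. Applying
   k differences with arbitrary steps to the k-fold antiderivative of sigma gives a profile
   s with k + 1 derivatives; expanding s(wy + x) at w = 0 shows that y^(k+1) is a profile as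
   soon as y^0, ..., y^k are and the (k+1)-st derivative of s, which is a k-fold difference
   of sigma', is nonzero at x. If it vanished for all steps and all x, then all (k+1)-fold
   differences of sigma would be zero and sigma would be a polynomial.

   Hence all polynomial ridge functions, and so all polynomials in two variables, are
   limits of networks, and the Bernstein polynomials of a C^1 function on a rectangle
   converge to it in C^1. *)

Require Import Defs.
From HB Require Import structures.
From mathcomp Require Import all_boot all_order all_algebra.
From mathcomp Require Import all_classical all_reals all_analysis.
From mathcomp Require Import ring lra.
Set Implicit Arguments.
Unset Strict Implicit.
Unset Printing Implicit Defensive.
Import Order.TTheory GRing.Theory Num.Theory.
Import numFieldNormedType.Exports.
Local Open Scope classical_set_scope.
Local Open Scope ring_scope.

(** * Closed spans *)

Section ClosedSpan.
Context {R : realType} {X I : Type}.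
Variables (D : set X) (E : I -> X -> R).

Definition lincomb (l : seq (R * I)) (x : X) : R :=
  \sum_(p <- l) p.1 * E p.2 x.

Definition closed_span (f : X -> R) : Prop :=
  forall eps, 0 < eps ->
    exists l, forall x, D x -> `|f x - lincomb l x| <= eps.

Lemma closed_span_gen i : closed_span (E i).
Proof.
move=> eps e0; exists [:: (1, i)] => x _.
by rewrite /lincomb big_seq1 mul1r subrr normr0 ltW.
Qed.

Lemma closed_span_lim f :
  (forall eps, 0 < eps -> exists2 g, closed_span g &
     forall x, D x -> `|f x - g x| <= eps) ->
  closed_span f.
Proof.
move=> fg eps e0; have e20 : 0 < eps / 2 by rewrite divr_gt0.
have [g /(_ _ e20)[l gl] fge] := fg _ e20; exists l => x Dx.
rewrite (splitr eps) -(subrKA (g x)) (le_trans (ler_normD _ _))//.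
by rewrite lerD// ?fge ?gl.
Qed.

Lemma eq_closed_span f g :
  (forall x, D x -> f x = g x) -> closed_span f -> closed_span g.
Proof.
move=> fg Sf eps /Sf[l fl]; exists l => x Dx.
by rewrite -fg// fl.
Qed.

Lemma closed_span0 : closed_span (fun=> 0).
Proof.
move=> eps e0; exists [::] => x _.
by rewrite /lincomb big_nil subrr normr0 ltW.
Qed.

Lemma closed_spanD f g : closed_span f -> closed_span g ->
  closed_span (fun x => f x + g x).
Proof.
move=> Sf Sg eps e0; have e20 : 0 < eps / 2 by rewrite divr_gt0.
have [l fl] := Sf _ e20; have [k gk] := Sg _ e20.
exists (l ++ k) => x Dx; rewrite /lincomb big_cat/= opprD addrACA.
rewrite (splitr eps) (le_trans (ler_normD _ _))//.
by rewrite lerD// ?fl ?gk.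
Qed.

Lemma closed_spanZ a f : closed_span f -> closed_span (fun x => a * f x).
Proof.
move=> Sf eps e0; have c0 : 0 < `|a| + 1 by rewrite ltr_wpDl.
have [l fl] := Sf _ (divr_gt0 e0 c0).
exists [seq (a * p.1, p.2) | p <- l] => x Dx.
rewrite /lincomb big_map/=; under eq_bigr do rewrite -mulrA.
rewrite -big_distrr/= -mulrBr normrM.
rewrite (le_trans (ler_wpM2l (normr_ge0 _) (fl _ Dx)))//.
by rewrite mulrCA ger_pMr// ler_pdivrMr// mul1r lerDl.
Qed.

Lemma closed_spanB f g : closed_span f -> closed_span g ->
  closed_span (fun x => f x - g x).
Proof.
move=> Sf /(closed_spanZ (-1)) Sg.
by apply: eq_closed_span (closed_spanD Sf Sg) => x _; rewrite mulN1r.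
Qed.

Lemma closed_span_sum (J : Type) (r : seq J) (a : J -> R) (f : J -> X -> R) :
  (forall j, closed_span (f j)) ->
  closed_span (fun x => \sum_(j <- r) a j * f j x).
Proof.
move=> Sf; elim: r => [|j r IH].
  by apply: eq_closed_span closed_span0 => x _; rewrite big_nil.
apply: eq_closed_span (closed_spanD (closed_spanZ (a j) (Sf j)) IH) => x _.
by rewrite big_cons.
Qed.

(** Recovers the coefficients of a function-valued polynomial in [a] from its values. Doubling [a]
    eliminates the top term, so no Vandermonde system has to be inverted. *)
Lemma closed_span_coef k (v : nat -> X -> R) :
  (forall a, closed_span (fun x => \sum_(m < k) a ^+ m * v m x)) ->
  forall m, (m < k)%N -> closed_span (v m).
Proof.
elim: k v => // k IH v Sv.
(* [Q (2a) - 2^k Q a] has no term of degree [k]. *)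
have Slow m : (m < k)%N -> closed_span (v m).
  move=> mk; have ne0 : (2 ^+ m - 2 ^+ k : R) != 0.
    by rewrite subr_eq0 (inj_eq (ieexprIn _ _)) ?ltn_eqF ?ltr0n ?pnatr_eq1.
  have S' : closed_span (fun x => (2 ^+ m - 2 ^+ k) * v m x).
    apply: (IH (fun m x => (2 ^+ m - 2 ^+ k) * v m x)) => // a.
    have := closed_spanB (Sv (2 * a)) (closed_spanZ (2 ^+ k) (Sv a)).
    apply: eq_closed_span => x _; rewrite mulr_sumr -sumrB big_ord_recr/=.
    rewrite exprMn mulrA subrr addr0; apply: eq_bigr => i _.
    by rewrite exprMn; ring.
  apply: eq_closed_span (closed_spanZ (2 ^+ m - 2 ^+ k)^-1 S') => x _.
  by rewrite mulrA mulVf// mul1r.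
(* The top coefficient is the value at [a = 1] minus all lower coefficients. *)
move=> m; rewrite ltnS leq_eqVlt => /predU1P[->|/Slow//].
have S' := @closed_span_sum _ (index_enum 'I_k) (fun=> 1) (fun i => v i)
  (fun i => Slow i (ltn_ord i)).
apply: eq_closed_span (closed_spanB (Sv 1) S') => x _.
rewrite big_ord_recr/= expr1n mul1r addrAC -sumrB big1 ?add0r// => i _.
by rewrite expr1n subrr.
Qed.

End ClosedSpan.

(** * Real analysis *)

Section RealAnalysis.
Context {R : realType}.

(** Compactness enters in its near-covering form, for the filter of radii tending to [0] from the
    right: small radii work near each point, hence on all of [K]. *)
Lemma Heine_Cantor (U : pseudoMetricType R) (K : set U) (f : U -> R) :
  compact K -> {within K, continuous f} ->
  forall eps, 0 < eps -> exists2 d, 0 < d &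
    forall p q, K p -> K q -> ball p d q -> `|f p - f q| <= eps.
Proof.
move=> /compact_near_coveringP cK /subspace_continuousP cf eps e0.
have e20 : 0 < eps / 2 by rewrite divr_gt0.
have : \forall d \near 0^'+, K `<=` (fun p =>
    K p -> forall q, K q -> ball p d q -> `|f p - f q| <= eps).
  apply: cK => x Kx.
  have /nbhs_ballP[r /= r0 xr] : nbhs x (fun y => K y -> `|f x - f y| <= eps / 2).
    have := cf x Kx; move/cvgrPdist_le => /(_ _ e20).
    by rewrite /within/= near_simpl.
  have r20 : 0 < r / 2 by rewrite divr_gt0.
  (* With both halves, [y] and any [q] within [d] of [y] lie in the ball of radius [r] around
     [x]. *)
  exists (ball x (r / 2), [set d | d < r / 2]) => /=.
    by split; [exact: nbhsx_ballx|exact: nbhs_right_lt].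
  move=> [y d] /= [xy dr] Ky q Kq yq.
  have fy : `|f x - f y| <= eps / 2.
    by apply: xr => //; apply: le_ball xy; rewrite ler_pdivrMr// mulr2n mulrDr mulr1 lerDl ltW.
  have fq : `|f x - f q| <= eps / 2.
    apply: xr => //; rewrite (splitr r); apply: (ball_triangle xy).
    by apply: le_ball yq; exact: ltW.
  rewrite (splitr eps) -(subrKA (f x)) (le_trans (ler_normD _ _))//.
  by rewrite lerD// distrC.
move=> H; have : \forall d \near 0^'+, 0 < d /\ K `<=` (fun p =>
    K p -> forall q, K q -> ball p d q -> `|f p - f q| <= eps :> R).
  by near=> d; split; [near: d; exact: nbhs_right_gt|near: d].
move=> /filter_ex[d [d0 Kd]]; exists d => // p q Kp Kq pq.
exact: Kd.
Unshelve. all: by end_near. Qed.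

Lemma compact_continuous_bounded (U : topologicalType) (K : set U) (f : U -> R) :
  compact K -> {within K, continuous f} ->
  exists2 M, 0 < M & forall p, K p -> `|f p| <= M.
Proof.
move=> cK cf; have /compact_bounded[M [_ HM]] := continuous_compact cf cK.
exists (`|M| + 1) => [|p Kp]; first by rewrite ltr_wpDl.
by apply: (HM (`|M| + 1)) => /=; [rewrite ltr_pwDr// ler_norm|exists p].
Qed.

(** An integral from [a] is differentiable only to the right of [a]. Normalised to vanish at [0],
    the integrals from different negative base points agree where both are defined, so they glue to
    an antiderivative on the whole line. *)
Lemma continuous_antiderivative (f : R -> R) : continuous f ->
  exists F : R -> R, forall x : R, is_derive x 1 F (f x).
Proof.
move=> cf.
pose F a x := parameterized_integral lebesgue_measure a x f.
have dF (a x : R) : a < x -> is_derive x 1 (F a) (f x).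
  move=> ax; have [dF <-] := @continuous_FTC1_closed R f a x (x + 1)
    (ltr_pwDr ltr01 (lexx _)) (continuous_compact_integrable
      (@segment_compact _ _ _) (continuous_subspaceT cf)) ax (cf x).
  by rewrite derive1E; exact: derivableP.
have FF (a b x : R) : a < 0 -> b < 0 -> a < x -> b < x ->
    F a x - F a 0 = F b x - F b 0.
  move=> a0 b0 ax bx.
  pose h := F a - F b.
  have dh (y : R) : a < y -> b < y -> is_derive y 1 h 0.
    move=> ay by_; have := dF _ _ ay; have := dF _ _ by_ => ? ?.
    by rewrite -(subrr (f y)); apply: is_deriveB.
  suff : h x = h 0 by rewrite /h/= !fctE => H; lra.
  have H (u v : R) : u <= v -> a < u -> b < u -> h u = h v.
    move=> uv au bu.
    have dh' (z : R) : u <= z -> is_derive z 1 h 0.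
      by move=> uz; apply: dh; apply: lt_le_trans uz.
    have [z zuv|z zuv|c _] := @MVT_segment R h (fun=> 0) u v uv.
    - by apply: dh'; rewrite (itvP zuv).
    - apply: derivable_within_continuous z zuv => z zuv.
      by apply: (@ex_derive _ _ _ _ _ _ 0); apply: dh'; rewrite (itvP zuv).
    by rewrite mul0r => /eqP; rewrite subr_eq0 => /eqP.
  by have [x0|/ltW x0] := leP x 0; [apply: H|apply/esym/H].
(* The base point moves with [x] so as to lie left of both [0] and [x]; near a given [x] it is
   exchanged for the fixed [a] below. *)
exists (fun x => F (- (`|x| + 1)) x - F (- (`|x| + 1)) 0) => x.
pose a := - (`|x| + 2).
have x1 : a < 0 by rewrite /a oppr_lt0 ltr_wpDl.
have ax : a < x by rewrite /a ltrNl (@le_lt_trans _ _ `|x|)// ?ltrDl// -normrN ler_norm.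
have dFa : is_derive x 1 (fun y => F a y - F a 0) (f x).
  have dFx := dF _ _ ax.
  by rewrite -[f x]subr0; apply: is_deriveB.
apply: near_eq_is_derive dFa.
near=> y.
have xy : `|x - y| < 1 by near: y; exact: nbhsx_ballx.
apply: FF => //.
- move: xy; rewrite ltr_norml => /andP[_ xy].
  by have := ler_norm (- x); rewrite normrN /a; lra.
- by rewrite ltrNl (@le_lt_trans _ _ `|y|)// ?ltrDl// -normrN ler_norm.
Unshelve. all: by end_near. Qed.

(** The integral of a nonnegative function is a supremum over simple functions below it, which is
    monotone without any measurability. The losses can thus be bounded without measurability of the
    residuals or of their inner integrals. *)
Lemma le_integral_of_le d (X : measurableType d)
    (mu : {measure set X -> \bar R}) (D : set X) (f g : X -> \bar R) :
  (forall x, D x -> (0 <= f x)%E) -> (forall x, D x -> (f x <= g x)%E) ->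
  (\int[mu]_(x in D) f x <= \int[mu]_(x in D) g x)%E.
Proof.
move=> f0 fg; rewrite (integral_mkcond D f) (integral_mkcond D g).
have f0' x : (0 <= (f \_ D) x)%E.
  by rewrite patchE; case: ifPn => // /set_mem; exact: f0.
have fg' x : ((f \_ D) x <= (g \_ D) x)%E.
  by rewrite !patchE; case: ifPn => // /set_mem; exact: fg.
rewrite !ge0_integralTE//; last by move=> x; exact: le_trans (fg' x).
apply: le_ereal_sup => _ [h hf <-]; exists h => // x.
exact: le_trans (hf x) (fg' x).
Qed.

End RealAnalysis.

(** * Iterated differences and Taylor expansions *)

Section Differences.
Context {R : realType}.
Implicit Types (f df : R -> R) (h : R) (hs : seq R).

Definition has_derivative f df : Prop := forall x : R, is_derive x 1 f (df x).

Lemma has_derivative_continuous f df : has_derivative f df -> continuous f.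
Proof.
move=> dfE x; apply/differentiable_continuous/derivable1_diffP.
exact: (@ex_derive _ _ _ _ _ _ (df x)).
Qed.

(** Measuring [c] from [x] avoids ordering [x] and [y], since increments of either sign occur
    later. *)
Lemma has_derivative_MVT f df (x y : R) : has_derivative f df ->
  exists2 c, `|c - x| <= `|y - x| & f y - f x = df c * (y - x).
Proof.
move=> dfE.
have H (a b : R) : a <= b -> exists2 c, a <= c <= b & f b - f a = df c * (b - a).
  move=> ab; have [//|z|c cab fab] := @MVT_segment _ f df a b ab.
    exact/continuous_subspaceT/has_derivative_continuous/dfE.
  by exists c => //; rewrite !(itvP cab).
have [xy|/ltW yx] := leP x y.
  have [c /andP[xc cy] ->] := H _ _ xy; exists c => //.
  by rewrite !ger0_norm ?subr_ge0// lerB.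
have [c /andP[yc cx] fE] := H _ _ yx; exists c => //.
  by rewrite !ler0_norm ?subr_le0// lerN2 lerB.
by rewrite -opprB fE -mulrN opprB.
Qed.

Lemma has_derivative_shift f df h :
  has_derivative f df -> has_derivative (fun x => f (x + h)) (fun x => df (x + h)).
Proof.
move=> dfE x; rewrite -[df _]mulr1.
apply: (@is_derive1_comp _ f (shift h)) => //.
exact: is_derive_shift.
Qed.

Lemma has_derivative_diff f df h : has_derivative f df ->
  has_derivative (fun x => f (x + h) - f x) (fun x => df (x + h) - df x).
Proof.
move=> dfE x; have d1 := has_derivative_shift h dfE x; have d2 := dfE x.
exact: (@is_deriveB _ _ _ (fun x => f (x + h)) f).
Qed.

Lemma has_derivative_poly (p : {poly R}) :
  has_derivative (horner p) (horner p^`()).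
Proof. by move=> x; exact: is_derive_poly. Qed.

Lemma has_derivative_eq f df g : has_derivative f df -> has_derivative g df ->
  forall x y, f x - g x = f y - g y.
Proof.
move=> dfE dgE x y; apply: (@is_derive_0_is_cst _ (f - g)) => z.
have d1 := dfE z; have d2 := dgE z.
by rewrite -(subrr (df z)); exact: is_deriveB.
Qed.

Lemma has_derivative_polynomial f (p : {poly R}) :
  has_derivative f (horner p) ->
  exists q : {poly R}, (size q <= (size p).+1)%N /\ forall x, f x = q.[x].
Proof.
move=> dfE; pose q : {poly R} := \poly_(i < (size p).+1) (p`_i.-1 / i%:R).
have qp : q^`() = p.
  apply/polyP => i; rewrite coef_deriv coef_poly ltnS.
  have [ip|ip] := ltnP i (size p).
    by rewrite -[LHS]mulr_natr -mulrA mulVf ?mulr1// pnatr_eq0.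
  by rewrite mul0rn nth_default.
exists (q + (f 0 - q.[0])%:P); split.
  rewrite (leq_trans (size_polyD _ _))// geq_max size_poly/=.
  by rewrite (leq_trans (size_polyC_leq1 _)).
move=> x; have := has_derivative_poly q; rewrite qp => dq.
by rewrite hornerD hornerC -(has_derivative_eq dfE dq x 0) addrC subrK.
Qed.

(** Polynomials of size at most [k.+1] are fixed by their values at [0, ..., k]. Lagrange
    interpolation is continuous in these values, so the limit is the interpolant of its own
    values. *)
Lemma polynomial_pointwise_limit (I : Type) (F : set_system I)
    {FF : ProperFilter F} k (p : I -> {poly R}) f :
  (forall i, (size (p i) <= k.+1)%N) ->
  (forall x, (p i).[x] @[i --> F] --> f x) ->
  exists q : {poly R}, (size q <= k.+1)%N /\ forall x, f x = q.[x].
Proof.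
move=> pk pf; pose x_ (i : nat) : R := i%:R.
have x_inj : injective x_ by move=> i j /eqP; rewrite eqr_nat => /eqP.
pose L i := tnth (lagrange k.+1 x_) i : {poly R}.
exists (\sum_(i < k.+1) (f (x_ i))%:P * L i); split.
  rewrite (leq_trans (size_sum _ _ _))//; apply/bigmax_leqP => i _.
  by rewrite mul_polyC (leq_trans (size_scale_leq _ _))// size_lagrange_.
move=> x; suff H : (p i).[x] @[i --> F] --> (\sum_(i < k.+1) (f (x_ i))%:P * L i).[x].
  exact: cvg_unique (pf x) H.
have -> : (fun i => (p i).[x]) =
    (fun i => \sum_(j < k.+1) (p i).[x_ j] * (L j).[x]).
  apply/funext => i; rewrite [in LHS](lagrange_gen (ltn0Sn k) x_inj (pk i)).
  by rewrite horner_sum; apply: eq_bigr => j _; rewrite hornerM hornerC.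
rewrite horner_sum; apply: cvg_big => [|j _]; first exact: add_continuous.
by rewrite hornerM hornerC; apply: cvgMl.
Qed.

Fixpoint diffs hs f : R -> R :=
  if hs is h :: hs' then diffs hs' (fun x => f (x + h) - f x) else f.

Lemma has_derivative_diffs hs f df :
  has_derivative f df -> has_derivative (diffs hs f) (diffs hs df).
Proof.
by elim: hs f df => //= h hs IH f df /(has_derivative_diff h) /IH.
Qed.

(* A function in the kernel of all [k]-fold differences has differences [f (. + h) - f]
   that are polynomials, by induction, so its derivative is a limit of polynomials of
   bounded size. *)
Lemma diffs_eq0_polynomial k f df : has_derivative f df ->
  (forall hs, size hs = k -> forall x, diffs hs f x = 0) ->
  exists p : {poly R}, (size p <= k.*2)%N /\ forall x, f x = p.[x].
Proof.
elim: k f df => [|k IH] f df dfE f0.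
  by exists 0; rewrite size_poly0; split => // x; rewrite horner0; exact: (f0 [::]).
have /choice[p pE] (h : R) : exists p : {poly R},
    (size p <= k.*2)%N /\ forall x, f (x + h) - f x = p.[x].
  apply: (IH _ _ (has_derivative_diff h dfE)) => hs hsk.
  by apply: (f0 (h :: hs)); rewrite /= hsk.
(* The size bound grows by two per difference: one because the limit lemma takes a bound of the form
   [k.+1], one for the antiderivative. *)
have [|x|q [qk dfq]] := @polynomial_pointwise_limit R (0^') _ k.*2
    (fun h => h^-1 *: p h) df.
- move=> h; rewrite (leq_trans (size_scale_leq _ _))//.
  by rewrite (leq_trans (pE h).1).
- have [/cvg_ex[l /= fl] dl] := dfE x.
  have <- : l = df x by rewrite -dl; apply/esym/cvg_lim.
  apply: cvg_trans fl; apply: near_eq_cvg; near=> h.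
  by rewrite hornerZ -(pE h).2 [h *: 1]mulr1 (addrC x).
have [|r [rq fr]] := @has_derivative_polynomial f q.
  by move=> x; rewrite -dfq.
by exists r; split => //; rewrite (leq_trans rq)// doubleS ltnS.
Unshelve. all: by end_near. Qed.

End Differences.

Section Taylor.
Context {R : realType}.
Variable S : nat -> R -> R.
Hypothesis S0_cont : continuous (S 0%N).
Hypothesis S_deriv : forall j, has_derivative (S j.+1) (S j).

(** As [S (j - i)] is the [i]-th derivative of [S j], this is the Taylor polynomial of [S j] at [x],
    of order [j], in the increment. *)
Definition taylor (j : nat) (x : R) : {poly R} :=
  \poly_(i < j.+1) (S (j - i) x / i`!%:R).

Lemma taylor_deriv j x : (taylor j.+1 x)^`() = taylor j x.
Proof.
apply/polyP => i; rewrite coef_deriv !coef_poly ltnS.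
case: ifP => _; last by rewrite mul0rn.
by rewrite subSS -[LHS]mulr_natr -mulrA factS natrM invfM mulrAC mulVf ?mul1r.
Qed.

(** Peano remainder by induction: order [0] is continuity of [S 0]. The derivative of the next
    remainder is the current one, so the mean value theorem adds a factor of [u] and the same [d]
    works at every order. *)
Lemma taylor_peano j x eps : 0 < eps -> exists2 d, 0 < d &
  forall u, `|u| <= d -> `|S j (x + u) - (taylor j x).[u]| <= eps * `|u| ^+ j.
Proof.
move=> e0; elim: j => [|j [d d0 IH]].
  have := S0_cont (x := x); move/cvgrPdist_le => /(_ _ e0).
  move=> /nbhs_ballP[r /= r0 xr]; exists (r / 2); first by rewrite divr_gt0.
  move=> u ur; have -> : (taylor 0 x).[u] = S 0%N x.
    by rewrite horner_poly big_ord1 subn0 fact0 divr1 expr0 mulr1.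
  rewrite expr0 mulr1 distrC; apply: xr; rewrite /ball/= opprD addNKr normrN.
  by rewrite (le_lt_trans ur)// ltr_pdivrMr// mulr2n mulrDr mulr1 ltrDl.
exists d => // u ud.
pose r v := S j.+1 (x + v) - (taylor j.+1 x).[v].
pose dr v := S j (x + v) - (taylor j x).[v].
have drE : has_derivative r dr.
  move=> v; have d1 := has_derivative_shift x (S_deriv j) v.
  have d2 := has_derivative_poly (taylor j.+1 x) v; rewrite taylor_deriv in d2.
  rewrite /dr (addrC x) (_ : r = (fun v => S j.+1 (v + x)) - horner (taylor j.+1 x)).
    exact: is_deriveB.
  by apply/funext => w; rewrite /r (addrC x).
have r0 : r 0 = 0.
  rewrite /r addr0 horner_poly big_ord_recl/= big1 => [|i _].
    by rewrite expr0 mulr1 subn0 fact0 divr1 addr0 subrr.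
  by rewrite exprS mul0r mulr0.
have [c] := has_derivative_MVT 0 u drE; rewrite !subr0 r0 subr0 -/(r u) => cu ->.
rewrite normrM exprSr mulrA ler_wpM2r//.
rewrite (le_trans (IH _ (le_trans cu ud)))// ler_wpM2l ?(ltW e0)//.
by rewrite lerXn2r// nnegrE.
Qed.

End Taylor.

(** * Profiles *)

Lemma horner_deriv_coef {R : nzRingType} (p : {poly R}) y :
  p^`().[y] = \sum_(i < size p) p`_i * ('X^i)^`().[y].
Proof.
rewrite -[in LHS](coefK p) poly_def raddf_sum horner_sum.
by apply: eq_bigr => i _; rewrite /= derivZ hornerZ.
Qed.

Section Profiles.
Context {R : realType}.
Variables (K : set (R * R)) (B : R).
Hypothesis K_bounded : forall z, K z -> `|z.1| <= B /\ `|z.2| <= B.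
Variables (sigma dsigma : R -> R).

(* The first component of the argument selects the value ([None]), the derivative
   in the first variable ([Some false]) or in the second one ([Some true]), so that
   uniform approximation of jets is approximation of scalar functions. *)
Definition jet (f ft fx : R * R -> R) (x : option bool * (R * R)) : R :=
  match x.1 with
  | None => f x.2
  | Some false => ft x.2
  | Some true => fx x.2
  end.

Definition ridge_arg (p : R * R * R) (z : R * R) : R :=
  p.1.1 * z.1 + p.1.2 * z.2 + p.2.

Definition ridge (s ds : R -> R) (p : R * R * R) : option bool * (R * R) -> R :=
  jet (fun z => s (ridge_arg p z))
      (fun z => p.1.1 * ds (ridge_arg p z))
      (fun z => p.1.2 * ds (ridge_arg p z)).

Definition jet_span : (option bool * (R * R) -> R) -> Prop :=
  closed_span [set x | K x.2] (ridge sigma dsigma).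

Definition profile (s ds : R -> R) : Prop := forall p, jet_span (ridge s ds p).

Lemma profile_gen : profile sigma dsigma.
Proof. by move=> p; exact: closed_span_gen. Qed.

Lemma profileZ a s ds : profile s ds ->
  profile (fun y => a * s y) (fun y => a * ds y).
Proof.
move=> Ps p; apply: eq_closed_span (closed_spanZ a (Ps p)).
by move=> [[[|]|] z] _ //=; rewrite /ridge/jet/= mulrCA.
Qed.

Lemma profileB s ds s' ds' : profile s ds -> profile s' ds' ->
  profile (fun y => s y - s' y) (fun y => ds y - ds' y).
Proof.
move=> Ps Ps' p; apply: eq_closed_span (closed_spanB (Ps p) (Ps' p)).
by move=> [[[|]|] z] _ //=; rewrite /ridge/jet/= mulrBr.
Qed.

Lemma profile_sum (J : Type) (r : seq J) (a : J -> R) (s ds : J -> R -> R) :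
  (forall j, profile (s j) (ds j)) ->
  profile (fun y => \sum_(j <- r) a j * s j y) (fun y => \sum_(j <- r) a j * ds j y).
Proof.
move=> Ps p; apply: eq_closed_span (closed_span_sum r a (fun j => Ps j p)).
by move=> [[[|]|] z] _ //=; rewrite /ridge/jet/= mulr_sumr;
  apply: eq_bigr => j _; rewrite mulrCA.
Qed.

Lemma profile_affine a b s ds : profile s ds ->
  profile (fun y => s (a * y + b)) (fun y => a * ds (a * y + b)).
Proof.
move=> Ps [[p1 p2] p3].
apply: eq_closed_span (Ps (a * p1, a * p2, a * p3 + b)).
have E (z : R * R) : ridge_arg (a * p1, a * p2, a * p3 + b) z =
    a * ridge_arg (p1, p2, p3) z + b.
  by rewrite /ridge_arg/=; ring.
by move=> [[[|]|] z] _ //=; rewrite /ridge/jet/= E// mulrCA mulrA.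
Qed.

(** On the bounded set [K] the argument of a ridge function stays in a segment, so locally uniform
    convergence of the pair suffices. *)
Lemma profile_lim s ds :
  (forall M eps, 0 < eps -> exists s' ds', profile s' ds' /\
    forall y, `|y| <= M -> `|s y - s' y| <= eps /\ `|ds y - ds' y| <= eps) ->
  profile s ds.
Proof.
move=> H [[a b] c]; apply: closed_span_lim => eps e0.
(* This constant dominates the factors [1], [a] and [b] in front of the three components of the
   jet. *)
have C0 : 0 < 1 + `|a| + `|b| by rewrite !ltr_wpDr.
have [s' [ds' [Ps' ss']]] := H (`|a| * B + `|b| * B + `|c|) _ (divr_gt0 e0 C0).
exists (ridge s' ds' (a, b, c)); first exact: Ps'.
move=> [b0 z] /= /K_bounded[z1 z2].
have /ss'[ss ds_] : `|ridge_arg (a, b, c) z| <= `|a| * B + `|b| * B + `|c|.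
  rewrite (le_trans (ler_normD _ _))// lerD2r (le_trans (ler_normD _ _))//.
  by rewrite !normrM lerD// ler_wpM2l.
have E t : t <= 1 + `|a| + `|b| -> t * (eps / (1 + `|a| + `|b|)) <= eps.
  by move=> tC; rewrite mulrCA ger_pMr// ler_pdivrMr// mul1r.
case: b0 => [[|]|]; rewrite /ridge/jet/=.
- rewrite -mulrBr normrM (le_trans (ler_wpM2l (normr_ge0 _) ds_))// E//.
  by rewrite lerDr addr_ge0.
- rewrite -mulrBr normrM (le_trans (ler_wpM2l (normr_ge0 _) ds_))// E//.
  by rewrite addrAC lerDr addr_ge0.
- by rewrite -[leLHS]mul1r (le_trans (ler_wpM2l ler01 ss))// E// -addrA lerDl addr_ge0.
Qed.

(** * Differences of antiderivatives as limits of Riemann sums *)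

Lemma continuous_unif_on_segment (f : R -> R) M eps : continuous f -> 0 < eps ->
  exists2 d, 0 < d & forall x y, `|x| <= M -> `|y| <= M -> `|x - y| < d ->
    `|f x - f y| <= eps.
Proof.
move=> cf e0.
have [d d0 H] := Heine_Cantor (@segment_compact _ (- M) M)
  (continuous_subspaceT cf) e0.
by exists d => // x y xM yM xy; apply: H => //=; rewrite in_itv/= -ler_norml.
Qed.

(** The increment of [F] telescopes over the nodes. By the mean value theorem each piece is the mesh
    times [f] at a point within one mesh of its node. *)
Lemma riemann_sum_error (F f : R -> R) (M h eps d : R) (n : nat) :
  has_derivative F f ->
  (forall x y, `|x| <= M + `|h| -> `|y| <= M + `|h| -> `|x - y| < d ->
    `|f x - f y| <= eps) ->
  `|h| / n.+1%:R < d ->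
  forall y, `|y| <= M ->
  `|(F (y + h) - F y) - \sum_(i < n.+1) h / n.+1%:R * f (y + i%:R * (h / n.+1%:R))|
    <= `|h| * eps.
Proof.
move=> dF fd hd y yM; pose x (i : nat) := y + i%:R * (h / n.+1%:R).
have -> : F (y + h) - F y = \sum_(i < n.+1) (F (x i.+1) - F (x i)).
  rewrite -(big_mkord xpredT (fun i => F (x i.+1) - F (x i))) telescope_sumr//.
  by rewrite /x mul0r addr0 mulrCA divff ?mulr1// pnatr_eq0.
rewrite -sumrB (le_trans (ler_norm_sum _ _ _))//.
have -> : `|h| * eps = \sum_(i < n.+1) (`|h| / n.+1%:R * eps).
  by rewrite sumr_const card_ord -[RHS]mulr_natr mulrAC divfK// pnatr_eq0.
apply: ler_sum => i _; have [c cx ->] := has_derivative_MVT (x i) (x i.+1) dF.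
have xx : x i.+1 - x i = h / n.+1%:R by rewrite /x -natr1; ring.
have nh : `|h / n.+1%:R| = `|h| / n.+1%:R by rewrite normrM normfV normr_nat.
rewrite xx nh in cx; rewrite xx -/(x i) mulrC -mulrBr normrM nh.
(* A node shifted by one mesh still satisfies the bound required by [fd]. *)
have h1 : `|h| / n.+1%:R * i.+1%:R <= `|h|.
  by rewrite mulrAC ler_pdivrMr// ler_wpM2l// ler_nat.
have h2 : 0 <= `|h| / n.+1%:R by rewrite divr_ge0.
have xi : `|x i| <= M + `|h| / n.+1%:R * i%:R.
  rewrite (le_trans (ler_normD _ _))// lerD// normrM nh normr_nat.
  by rewrite mulrC.
rewrite -[i.+1%:R]natr1 mulrDr mulr1 in h1.
rewrite ler_wpM2l//; apply: fd.
- rewrite -(subrK (x i) c) (le_trans (ler_normD _ _))// addrC.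
  by rewrite (le_trans (lerD xi cx))// -addrA lerD2l.
- by rewrite (le_trans xi)// lerD2l (le_trans _ h1)// lerDl.
- exact: le_lt_trans cx hd.
Qed.

(** [S (y + h) - S y] is the integral of [s] over translates of [y], and its derivative the same
    integral of [ds]. Both are locally uniform limits of the same Riemann means, which are
    profiles. *)
Lemma profile_diff (S s ds : R -> R) h :
  has_derivative S s -> has_derivative s ds -> continuous ds ->
  profile s ds ->
  profile (fun y => S (y + h) - S y) (fun y => s (y + h) - s y).
Proof.
move=> dS dS' cds Ps; apply: profile_lim => M eps e0.
have h0 : 0 < `|h| + 1 by rewrite ltr_wpDl.
pose e := eps / (`|h| + 1); have e'0 : 0 < e by rewrite divr_gt0.
have [d1 d10 H1] := continuous_unif_on_segment (M + `|h|)
  (has_derivative_continuous dS') e'0.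
have [d2 d20 H2] := continuous_unif_on_segment (M + `|h|) cds e'0.
have he : `|h| * e <= eps.
  by rewrite /e mulrCA ger_pMr// ler_pdivrMr// mul1r lerDl.
pose d := Num.min d1 d2.
have d0 : 0 < d by rewrite lt_min d10.
pose n := Num.truncn (`|h| / d).
have nd : `|h| / n.+1%:R < d.
  by rewrite ltr_pdivrMr// mulrC -ltr_pdivrMr// truncnS_gt.
move: (nd); rewrite lt_min => /andP[nd1 nd2].
pose r := index_enum 'I_n.+1.
(* The factor [1] gives the summands the shape of [profile_affine]. *)
exists (fun y => \sum_(i <- r) h / n.+1%:R * s (1 * y + i%:R * (h / n.+1%:R))).
exists (fun y => \sum_(i <- r)
   h / n.+1%:R * (1 * ds (1 * y + i%:R * (h / n.+1%:R)))).
split.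
  apply: (@profile_sum _ r (fun=> h / n.+1%:R)
    (fun i y => s (1 * y + i%:R * (h / n.+1%:R)))
    (fun i y => 1 * ds (1 * y + i%:R * (h / n.+1%:R)))) => i.
  exact: profile_affine.
move=> y yM; split; apply: le_trans he.
  under [X in _ - X]eq_bigr do rewrite mul1r.
  exact: riemann_sum_error nd1 y yM.
under [X in _ - X]eq_bigr do rewrite !mul1r.
exact: riemann_sum_error nd2 y yM.
Qed.

(** * Monomials as profiles *)

Definition poly_profile (p : {poly R}) : Prop := profile (horner p) (horner p^`()).

Lemma poly_profile_size k (p : {poly R}) : (forall i, (i < k)%N -> poly_profile 'X^i) ->
  (size p <= k)%N -> poly_profile p.
Proof.
move=> Pk pk.
pose q (i : 'I_(size p)) : {poly R} := 'X^i.
have Pq i : poly_profile (q i) by apply: Pk; exact: leq_trans pk.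
have := profile_sum (index_enum _) (fun i : 'I_(size p) => p`_i) Pq.
have E1 : (fun y => \sum_(i < size p) p`_i * (q i).[y]) = horner p.
  by apply/funext => y; rewrite horner_coef; apply: eq_bigr => i _; rewrite hornerXn.
have E2 : (fun y => \sum_(i < size p) p`_i * (q i)^`().[y]) = horner p^`().
  by apply/funext => y; rewrite horner_deriv_coef.
by rewrite E1 E2.
Qed.

(** Let [q] be the part of degree at most [k] of the Taylor polynomial of [S k.+1] at [x].
    Subtracting [q] and dividing by [w ^+ k.+1] leaves [c] times the monomial, up to the Peano
    remainder. The derivatives in [y] converge by the expansion of [S k], whose Taylor polynomial is
    the derivative of the other. *)
Lemma poly_profile_step (S : nat -> R -> R) k x :
  continuous (S 0%N) -> (forall j, has_derivative (S j.+1) (S j)) ->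
  profile (S k.+1) (S k) -> S 0%N x != 0 ->
  (forall i, (i <= k)%N -> poly_profile 'X^i) -> poly_profile 'X^(k.+1).
Proof.
move=> cS dS PS Sx Pk; pose t := taylor S k.+1 x.
pose q : {poly R} := \poly_(i < k.+1) t`_i.
pose c := t`_k.+1.
have c0 : c != 0.
  by rewrite /c coef_poly ltnSn subnn mulf_neq0// invr_eq0 pnatr_eq0 -lt0n fact_gt0.
have tE : t = q + c *: 'X^(k.+1).
  apply/polyP => i; rewrite coefD coefZ coefXn [q`_i]coef_poly /c.
  have [ik|ik|->] := ltngtP i k.+1; rewrite ?mulr0 ?addr0 ?mulr1 ?add0r//.
  by apply: nth_default; exact: leq_trans (size_poly _ _) ik.
have dtE : taylor S k x = q^`() + c *: ('X^(k.+1))^`().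
  by rewrite -taylor_deriv -/t tE derivD derivZ.
have Pq : poly_profile q by apply: (@poly_profile_size k.+1) (size_poly _ _).
suff : profile (fun y => c * 'X^(k.+1).[y]) (fun y => c * 'X^(k.+1)^`().[y]).
  move=> /(profileZ c^-1).
  by congr profile; apply/funext => y; rewrite mulrA mulVf// mul1r.
apply: profile_lim => M eps e0.
(* [M1] is at least [1], so [M1 ^+ k <= M1 ^+ k.+1] and one [e] serves both the value and the
   derivative. *)
pose M1 := `|M| + 1; have M10 : 0 < M1 by rewrite ltr_wpDl.
pose e := eps / M1 ^+ k.+1.
have e'0 : 0 < e by rewrite divr_gt0// exprn_gt0.
have [d1 d10 H1] := taylor_peano cS dS k.+1 x e'0.
have [d2 d20 H2] := taylor_peano cS dS k x e'0.
pose d := Num.min d1 d2.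
have d0 : 0 < d by rewrite lt_min d10.
pose w := d / M1; have w0 : 0 < w by rewrite divr_gt0.
pose W := (w ^+ k.+1)^-1.
exists (fun y => W * (S k.+1 (w * y + x) - q.[w * y + 0])).
exists (fun y => W * (w * S k (w * y + x) - w * q^`().[w * y + 0])).
split.
  apply: profileZ; apply: profileB; first exact: profile_affine.
  exact: (@profile_affine w 0 (horner q)).
move=> y yM.
have yM1 : `|y| <= M1 by rewrite (le_trans yM)// (le_trans (ler_norm M))// lerDl.
have wy : `|w * y| <= d.
  rewrite normrM gtr0_norm// /w -mulrA ger_pMr// mulrC ler_pdivrMr// mul1r//.
move: (wy); rewrite le_min => /andP[wy1 wy2].
rewrite addr0 (addrC _ x).
have wk0 n : 0 < w ^+ n by rewrite exprn_gt0.
split.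
  have -> : c * 'X^(k.+1).[y] - W * (S k.+1 (x + w * y) - q.[w * y]) =
      - (W * (S k.+1 (x + w * y) - t.[w * y])).
    rewrite tE hornerD hornerZ !hornerXn exprMn.
    have : W * w ^+ k.+1 = 1 by rewrite mulVf// gt_eqF.
    move: (w ^+ k.+1) (y ^+ k.+1) (S _ _) (q.[_]) => a b s r Wa.
    rewrite [X in X - _](_ : _ = c * b * (W * a)); last by rewrite Wa mulr1.
    by ring.
  rewrite normrN normrM gtr0_norm ?invr_gt0//.
  rewrite ler_pdivrMl// (le_trans (H1 _ wy1))// normrM exprMn gtr0_norm//.
  rewrite mulrCA ler_wpM2l ?(ltW (wk0 _))// /e mulrAC ler_pdivrMr ?exprn_gt0//.
  by rewrite ler_wpM2l ?(ltW e0)// lerXn2r// nnegrE ltW.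
have -> : c * 'X^(k.+1)^`().[y] - W * (w * S k (x + w * y) - w * q^`().[w * y]) =
    - (W * w * (S k (x + w * y) - (taylor S k x).[w * y])).
  rewrite dtE hornerD hornerZ derivXn !hornerMn !hornerXn exprMn.
  rewrite -[y ^+ k *+ _]mulr_natr -[_ * y ^+ k *+ _]mulr_natr.
  have : W * w * w ^+ k = 1 by rewrite -mulrA -exprS mulVf// gt_eqF.
  move: (w ^+ k) (y ^+ k) (S _ _) (q^`().[_]) => a b s r Wa.
  rewrite [X in X - _](_ : _ = c * (b * k.+1%:R) * (W * w * a)); last by rewrite Wa mulr1.
  by ring.
have Ww : W * w = (w ^+ k)^-1.
  by rewrite /W exprS invfM mulrAC mulVf ?mul1r// gt_eqF.
rewrite normrN normrM Ww gtr0_norm ?invr_gt0//.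
rewrite ler_pdivrMl// (le_trans (H2 _ wy2))// normrM exprMn gtr0_norm//.
rewrite mulrCA ler_wpM2l ?(ltW (wk0 _))// /e mulrAC ler_pdivrMr ?exprn_gt0//.
rewrite ler_wpM2l ?(ltW e0)// (@le_trans _ _ (M1 ^+ k))//.
  by rewrite lerXn2r// nnegrE ltW.
by rewrite ler_weXn2l// lerDr.
Qed.

(* If [S 0 = dsigma], then [diffs hs (S k.+1)] with [k = size hs] is an iterated
   Riemann mean of translates of [sigma], with one more derivative per mean. *)
Lemma profile_diffs hs (S : nat -> R -> R) :
  continuous (S 0%N) -> (forall j, has_derivative (S j.+1) (S j)) ->
  profile (S 1%N) (S 0%N) ->
  profile (diffs hs (S (size hs).+1)) (diffs hs (S (size hs))).
Proof.
elim: hs S => [//|h hs IH] S cS dS PS /=.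
(* One difference shifts the family by one index: its member [0] is now a difference of [S 1], which
   is still continuous. *)
apply: (IH (fun j y => S j.+1 (y + h) - S j.+1 y)).
- by apply: has_derivative_continuous (has_derivative_diff h (dS _)).
- by move=> j; apply: has_derivative_diff.
- exact: profile_diff (dS 1%N) (dS 0%N) cS PS.
Qed.

Lemma poly_profile_Xn :
  has_derivative sigma dsigma -> continuous dsigma -> ~ is_polynomial sigma ->
  forall k, poly_profile 'X^k.
Proof.
move=> dsigmaE cdsigma npoly k.
have /choice[A AE] (f : R -> R) : exists F, continuous f -> has_derivative F f.
  have [cf|ncf] := pselect (continuous f); last by exists f.
  by have [F FE] := continuous_antiderivative cf; exists F.
(* [S 0] is the derivative of [sigma], [S 1] is [sigma], and each further index is one more
   antiderivative. *)
pose S j := if j is i.+1 then iter i A sigma else dsigma.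
have SS j : has_derivative (S j.+1) (S j) /\ continuous (S j.+1).
  elim: j => [|j [dS cS]]; first by split => //; exact: has_derivative_continuous dsigmaE.
  have dS' : has_derivative (S j.+2) (S j.+1) by exact: AE cS.
  by split => //; exact: has_derivative_continuous dS'.
have dS j : has_derivative (S j.+1) (S j) by have [] := SS j.
elim/ltn_ind: k => -[_|k IH].
  (* Degree [0]: freeze the argument at a point where [sigma] is nonzero; there is one because the
     zero function is a polynomial. *)
  have [x sx] : exists x, sigma x != 0.
    apply: contrapT => H; apply: npoly; exists 0 => x; rewrite horner0.
    by apply: contrapT => /eqP sx; apply: H; exists x.
  have := profileZ (sigma x)^-1 (profile_affine 0 x profile_gen).
  rewrite /poly_profile expr0 -[1]/(1%:P) derivC; congr profile; apply/funext => y.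
    by rewrite mul0r add0r mulVf// hornerC.
  by rewrite mul0r mulr0 horner0.
have [[hs [x [hsk sx]]]|H] :=
    pselect (exists hs x, size hs = k /\ diffs hs dsigma x != 0).
  apply: (@poly_profile_step (fun j => diffs hs (S j)) k x) => //.
  - elim: hs {hsk sx} (S 0%N) (cdsigma : continuous (S 0%N)) => // h hs IHhs f cf.
    apply: (IHhs (fun y => f (y + h) - f y)) => y; apply: continuousB; last exact: cf.
    by apply: continuous_comp; [apply: continuousD => //; exact: cst_continuous|exact: cf].
  - by move=> j; exact: has_derivative_diffs (dS j).
  - by rewrite -hsk; apply: profile_diffs => //; exact: profile_gen.
(* Now all [k]-fold differences of [sigma] have zero derivative, hence are constant, and one further
   difference annihilates them. *)
exfalso; apply: npoly.
have [|p [_ pE]] := diffs_eq0_polynomial (k := k.+1) dsigmaE; last by exists p.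
move=> hs hsk x.
(* Differences commute, so the one applied first can be applied last. *)
have [hs' [h [hs'k ->]]] : exists hs' h, size hs' = k /\
    diffs hs sigma = (fun x => diffs hs' sigma (x + h) - diffs hs' sigma x).
  case: hs hsk => // h hs [hsk]; exists hs, h; split => //=.
  elim: hs {hsk} (sigma) => //= g hs IHhs f.
  rewrite -IHhs; congr diffs; apply/funext => y.
  by rewrite [y + h + g]addrAC; ring.
apply/eqP; rewrite subr_eq0; apply/eqP; apply: is_derive_0_is_cst => y.
have := has_derivative_diffs hs' dsigmaE y.
suff -> : diffs hs' dsigma y = 0 by [].
by apply: contrapT => /eqP sy; apply: H; exists hs', y.
Qed.

End Profiles.

(** * Bernstein polynomials *)

Section Bernstein.
Context {R : realType}.
Implicit Types (phi psi : nat -> R) (t x : R).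

(* De Casteljau's recursion for the polynomial [\sum_i phi i * 'C(n, i) X^i (1 - X)^(n-i)]. *)
Fixpoint bernstein (n : nat) phi : {poly R} :=
  if n is m.+1 then
    'X * bernstein m (fun i => phi i.+1) + (1 - 'X) * bernstein m phi
  else (phi 0%N)%:P.

Lemma horner_bernsteinS n phi t : (bernstein n.+1 phi).[t] =
  t * (bernstein n (fun i => phi i.+1)).[t] + (1 - t) * (bernstein n phi).[t].
Proof. by rewrite /= !hornerE. Qed.

Lemma bernsteinB n phi psi :
  bernstein n (fun i => phi i - psi i) = bernstein n phi - bernstein n psi.
Proof.
elim: n phi psi => [|n IH] phi psi /=; first by rewrite polyCB.
by rewrite (IH (fun i => phi i.+1) (fun i => psi i.+1)) IH; ring.
Qed.

Lemma bernsteinZ n a phi : bernstein n (fun i => a * phi i) = a *: bernstein n phi.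
Proof.
elim: n phi => [|n IH] phi /=; first by rewrite polyCM mul_polyC.
by rewrite (IH (fun i => phi i.+1)) IH scalerDr !scalerAr.
Qed.

Lemma bernstein_cst n (a : R) : bernstein n (fun=> a) = a%:P.
Proof. by elim: n => //= n ->; ring. Qed.

(** Differentiating de Casteljau's recursion gives the difference of its two branches plus the
    recursion on their derivatives, which the induction hypothesis handles. *)
Lemma deriv_bernstein n phi : (bernstein n.+1 phi)^`() =
  bernstein n (fun i => n.+1%:R * (phi i.+1 - phi i)).
Proof.
rewrite bernsteinZ.
elim: n phi => [|n IH] phi.
  by rewrite /= scale1r !(derivD, derivM, derivN, derivX, derivC) polyCB; ring.
rewrite [bernstein n.+2 phi]/= derivD !derivM (IH (fun i => phi i.+1)) IH.
rewrite !(derivB, derivX, derivC).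
have -> : bernstein n.+1 (fun i => phi i.+1 - phi i) =
    bernstein n.+1 (fun i => phi i.+1) - bernstein n.+1 phi by exact: bernsteinB.
have E : bernstein n.+1 (fun i => phi i.+1) - bernstein n.+1 phi =
   'X * bernstein n (fun i => phi i.+2 - phi i.+1) +
   (1 - 'X) * bernstein n (fun i => phi i.+1 - phi i).
  by rewrite -bernsteinB.
(* The factor splits as [n.+1 + 1]: the [1] accounts for the difference of the branches, [n.+1] for
   their derivatives, combined through [E]. *)
rewrite -[in RHS]natr1 scalerDl scale1r {1}E scalerDr -!mul_polyC.
by move: (n.+1%:R)%:P => a /=; ring.
Qed.

Lemma bernstein_norm_le n phi psi t : 0 <= t <= 1 ->
  (forall i, (i <= n)%N -> `|phi i| <= psi i) ->
  `|(bernstein n phi).[t]| <= (bernstein n psi).[t].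
Proof.
move=> /andP[t0 t1]; elim: n phi psi => [|n IH] phi psi pp.
  by rewrite !hornerC pp.
rewrite !horner_bernsteinS (le_trans (ler_normD _ _))// !normrM.
have u0 : 0 <= 1 - t by rewrite subr_ge0.
rewrite (ger0_norm t0) (ger0_norm u0).
by apply: lerD; apply: ler_wpM2l; rewrite ?subr_ge0//; apply: IH => i ni;
  apply: pp => //; exact: leqW.
Qed.

(** Second moment of the binomial law about [a]: variance plus squared bias. The centre is arbitrary
    because the recursion shifts it to [a - 1]. *)
Lemma bernstein_moment2 n (a b c : R) t :
  (bernstein n (fun i => b + c * (i%:R - a) ^+ 2)).[t] =
  b + c * (n%:R * (t * (1 - t)) + (n%:R * t - a) ^+ 2).
Proof.
elim: n a => [|n IH] a; first by rewrite hornerC; ring.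
rewrite horner_bernsteinS IH.
have -> : (fun i => b + c * (i.+1%:R - a) ^+ 2) =
    (fun i => b + c * (i%:R - (a - 1)) ^+ 2).
  by apply/funext => i; rewrite -natr1; ring.
by rewrite IH -natr1; ring.
Qed.

Lemma bernstein_variance n (b c : R) t : 0 <= t <= 1 -> 0 <= c ->
  (bernstein n.+1 (fun i => b + c * (i%:R / n.+1%:R - t) ^+ 2)).[t]
    <= b + c / n.+1%:R.
Proof.
move=> /andP[t0 t1] c0.
have n0 : n.+1%:R != 0 :> R by rewrite pnatr_eq0.
have -> : (fun i => b + c * (i%:R / n.+1%:R - t) ^+ 2) =
    (fun i => b + c / n.+1%:R ^+ 2 * (i%:R - n.+1%:R * t) ^+ 2).
  by apply/funext => i; field.
rewrite bernstein_moment2 subrr expr0n/= addr0 lerD2l.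
have -> : c / n.+1%:R ^+ 2 * (n.+1%:R * (t * (1 - t))) = c / n.+1%:R * (t * (1 - t)).
  by field.
by rewrite ler_piMr ?divr_ge0//; nra.
Qed.

Definition bernstein2 (n m : nat) (F : nat -> nat -> R) (t x : R) : R :=
  (bernstein n (fun i => (bernstein m (F i)).[x])).[t].

(** Constants are reproduced, so [v] moves inside the sums. Positivity and the variance bound are
    then applied in [x] and in [t] in turn. *)
Lemma bernstein2_error n m (F : nat -> nat -> R) (v a c t x : R) :
  0 <= t <= 1 -> 0 <= x <= 1 -> 0 <= c ->
  (forall i j, (i <= n.+1)%N -> (j <= m.+1)%N ->
    `|F i j - v| <= a + c * (i%:R / n.+1%:R - t) ^+ 2 + c * (j%:R / m.+1%:R - x) ^+ 2) ->
  `|bernstein2 n.+1 m.+1 F t x - v| <= a + c / n.+1%:R + c / m.+1%:R.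
Proof.
move=> t01 x01 c0 Fv.
have -> : bernstein2 n.+1 m.+1 F t x - v =
    bernstein2 n.+1 m.+1 (fun i j => F i j - v) t x.
  rewrite /bernstein2 -[v in LHS](hornerC v t) -(bernstein_cst n.+1 v).
  rewrite -hornerN -hornerD -bernsteinB; congr horner; congr bernstein.
  apply/funext => i; rewrite -[v in LHS](hornerC v x) -(bernstein_cst m.+1 v).
  by rewrite -hornerN -hornerD -bernsteinB.
rewrite addrAC -addrA.
apply: (@le_trans _ _ (bernstein n.+1
    (fun i => (a + c / m.+1%:R) + c * (i%:R / n.+1%:R - t) ^+ 2)).[t]).
  apply: bernstein_norm_le => // i ni.
  apply: (@le_trans _ _ (bernstein m.+1 (fun j =>
      (a + c * (i%:R / n.+1%:R - t) ^+ 2) + c * (j%:R / m.+1%:R - x) ^+ 2)).[x]).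
    by apply: bernstein_norm_le => // j mj; exact: Fv.
  by rewrite addrAC bernstein_variance.
by rewrite addrA bernstein_variance.
Qed.

(** Uniform continuity on the unit square with a quadratic term covering distant points: this is the
    form that the second moment of Bernstein polynomials integrates exactly. *)
Definition unit_modulus (g : R -> R -> R) : Prop :=
  forall eps, 0 < eps -> exists2 C, 0 <= C &
    forall s t x y, 0 <= s <= 1 -> 0 <= t <= 1 -> 0 <= x <= 1 -> 0 <= y <= 1 ->
      `|g s x - g t y| <= eps + C * ((s - t) ^+ 2 + (x - y) ^+ 2).

(** Lets [g] be sampled near a node rather than at it. The displacement is at most [1], so its
    square is at most the mesh, and replacing the sample point by the node costs a factor [2]. *)
Lemma unit_modulus_sample (g : R -> R -> R) eps C n m (t x u w : R) i j :
  0 <= C ->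
  (forall s t x y, 0 <= s <= 1 -> 0 <= t <= 1 -> 0 <= x <= 1 -> 0 <= y <= 1 ->
      `|g s x - g t y| <= eps + C * ((s - t) ^+ 2 + (x - y) ^+ 2)) ->
  0 <= t <= 1 -> 0 <= x <= 1 -> 0 <= u <= 1 -> 0 <= w <= 1 ->
  `|u - i%:R / n.+1%:R| <= n.+1%:R^-1 -> `|w - j%:R / m.+1%:R| <= m.+1%:R^-1 ->
  `|g u w - g t x| <= (eps + 2 * C / n.+1%:R + 2 * C / m.+1%:R)
    + (2 * C) * (i%:R / n.+1%:R - t) ^+ 2 + (2 * C) * (j%:R / m.+1%:R - x) ^+ 2.
Proof.
move=> C0 H t01 x01 u01 w01 ui wj.
have E k (p q r : R) : `|p - q| <= k.+1%:R^-1 ->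
    (p - r) ^+ 2 <= 2 * k.+1%:R^-1 + 2 * (q - r) ^+ 2.
  move=> pq; have k0 : 0 <= k.+1%:R^-1 :> R by rewrite invr_ge0.
  have k1 : k.+1%:R^-1 <= 1 :> R by rewrite invf_le1// ler1n.
  have : (p - q) ^+ 2 <= k.+1%:R^-1.
    rewrite -real_normK ?num_real// expr2 (le_trans _ pq)// ler_piMr//.
    exact: le_trans pq k1.
  (* This square gives [(p - r) ^+ 2 <= 2 * (p - q) ^+ 2 + 2 * (q - r) ^+ 2]. *)
  have : 0 <= (p - q - (q - r)) ^+ 2 by exact: sqr_ge0.
  by move: (k.+1%:R^-1) => z; nra.
rewrite (le_trans (H _ _ _ _ u01 t01 w01 x01))//.
rewrite -2!addrA -!addrA lerD2l.
apply: le_trans (ler_wpM2l C0 (lerD (E _ _ _ t ui) (E _ _ _ x wj))) _.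
by rewrite le_eqVlt; apply/orP; left; apply/eqP; ring.
Qed.

(* The derivatives of a Bernstein polynomial of [g] are Bernstein polynomials of
   difference quotients of [g], that is, of values of [g1] or [g2] at points close to
   the nodes. *)
Lemma bernstein2_C1 (g g1 g2 : R -> R -> R) :
  unit_modulus g -> unit_modulus g1 -> unit_modulus g2 ->
  (forall x s t, 0 <= x <= 1 -> 0 <= s -> s < t -> t <= 1 ->
    exists2 c, s <= c <= t & g t x - g s x = g1 c x * (t - s)) ->
  (forall t x y, 0 <= t <= 1 -> 0 <= x -> x < y -> y <= 1 ->
    exists2 c, x <= c <= y & g t y - g t x = g2 t c * (y - x)) ->
  forall eps, 0 < eps -> exists n (F : nat -> nat -> R), forall t x,
    0 <= t <= 1 -> 0 <= x <= 1 ->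
    [/\ `|g t x - (bernstein n (fun i => (bernstein n (F i)).[x])).[t]| <= eps,
       `|g1 t x - (bernstein n (fun i => (bernstein n (F i)).[x]))^`().[t]| <= eps &
       `|g2 t x - (bernstein n (fun i => (bernstein n (F i))^`().[x])).[t]| <= eps].
Proof.
move=> mg mg1 mg2 H1 H2 eps e0; have e20 : 0 < eps / 2 by rewrite divr_gt0.
have [C C0 mC] := mg _ e20; have [C1 C10 mC1] := mg1 _ e20.
have [C2 C20 mC2] := mg2 _ e20.
(* Each error is [eps / 2] plus four terms of at most [2 * c / k.+1], where [c] is [C], [C1] or
   [C2]; the four sum to at most [D / k.+1 <= eps / 2]. *)
pose D := 8 * (C + C1 + C2) + 1.
have D0 : 0 < D by rewrite /D; lra.
pose k := Num.truncn (D / (eps / 2)).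
have kD : D / k.+1%:R <= eps / 2.
  by rewrite ler_pdivrMr// mulrC -ler_pdivrMr// ltW// truncnS_gt.
pose F (i j : nat) := g (i%:R / k.+2%:R) (j%:R / k.+2%:R).
have err c p q : 0 <= c -> 8 * c <= D -> (k <= p)%N -> (k <= q)%N ->
    eps / 2 + 2 * c / p.+1%:R + 2 * c / q.+1%:R
      + 2 * c / p.+1%:R + 2 * c / q.+1%:R <= eps.
  move=> c0 cD kp kq.
  have I r : (k <= r)%N -> 2 * c / r.+1%:R <= 2 * c / k.+1%:R.
    by move=> kr; rewrite ler_wpM2l ?mulr_ge0// lef_pV2 ?posrE// ler_nat.
  have := I _ kp; have := I _ kq.
  have : 8 * c / k.+1%:R <= D / k.+1%:R by rewrite ler_wpM2r// invr_ge0.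
  rewrite [8 * c / _](_ : _ = 4 * (2 * c / k.+1%:R)); last by ring.
  move: kD; move: (D / _) (2 * c / p.+1%:R) (2 * c / q.+1%:R) (2 * c / k.+1%:R).
  by move=> *; lra.
have node i n : (i <= n.+1)%N -> 0 <= (i%:R / n.+1%:R : R) <= 1.
  by move=> ik; rewrite divr_ge0//= ler_pdivrMr// mul1r ler_nat.
have nodeS (i n : nat) : i.+1%:R / n.+1%:R - i%:R / n.+1%:R = n.+1%:R^-1 :> R.
  by rewrite -mulrBl -natr1 addrAC subrr add0r mul1r.
(* Differentiation lowers the degree, so nodes become [i / k.+1] while [F] is sampled with mesh
   [1 / k.+2]. The new node lies in the cell from [i / k.+2] to [i.+1 / k.+2] that contains the mean
   value point [c]. *)
have near_node (c : R) i : (i <= k.+1)%N ->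
    i%:R / k.+2%:R <= c <= i.+1%:R / k.+2%:R ->
    0 <= c <= 1 /\ `|c - i%:R / k.+1%:R| <= k.+1%:R^-1.
  move=> ik /andP[ic ci].
  have /andP[_ i1] := node i.+1 k.+1 ik; have /andP[i0 _] := node i k.+1 (leqW ik).
  split; first by rewrite (le_trans i0 ic) (le_trans ci i1).
  have k1 : 0 < k.+1%:R :> R by [].
  have k2 : k.+2%:R = k.+1%:R + 1 :> R by rewrite natr1.
  have ik' : i%:R <= k.+1%:R :> R by rewrite ler_nat.
  have a1 : i%:R / k.+1%:R <= i.+1%:R / k.+2%:R :> R.
    rewrite ler_pdivrMr// mulrAC ler_pdivlMr// k2 -natr1; nra.
  have a2 : i%:R / k.+2%:R <= i%:R / k.+1%:R :> R.
    by rewrite ler_wpM2l// lef_pV2 ?posrE// ler_nat.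
  have a3 : k.+2%:R^-1 <= k.+1%:R^-1 :> R by rewrite lef_pV2 ?posrE// ler_nat.
  move: ic ci a1 a2 a3 (nodeS i k.+1); rewrite ler_norml.
  move: (k.+2%:R^-1) (k.+1%:R^-1) (i.+1%:R / _) (i%:R / k.+1%:R) (i%:R / k.+2%:R).
  by move=> *; lra.
have self i n : `|i%:R / n.+1%:R - i%:R / n.+1%:R| <= n.+1%:R^-1 :> R.
  by rewrite subrr normr0 invr_ge0.
exists k.+2, F => t x t01 x01.
have k0 : (k.+2%:R : R) != 0 by rewrite pnatr_eq0.
split; rewrite distrC.
- apply: le_trans (err C k.+1 k.+1 C0 _ _ _); rewrite ?leqnSn//; last by rewrite /D; lra.
  apply: bernstein2_error; rewrite ?mulr_ge0// => i j ik jk.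
  by apply: unit_modulus_sample => //; exact: node.
- rewrite deriv_bernstein.
  rewrite [X in X - _](_ : _ = bernstein2 k.+1 k.+2
      (fun i j => k.+2%:R * (F i.+1 j - F i j)) t x); last first.
    rewrite /bernstein2; congr horner; congr bernstein; apply/funext => i.
    by rewrite bernsteinZ hornerZ bernsteinB hornerD hornerN.
  apply: le_trans (err C1 k k.+1 C10 _ _ _); rewrite ?leqnSn//; last by rewrite /D; lra.
  apply: bernstein2_error; rewrite ?mulr_ge0// => i j ik jk.
  have [||||c ic E] := H1 (j%:R / k.+2%:R) (i%:R / k.+2%:R) (i.+1%:R / k.+2%:R).
  + exact: node.
  + by have /andP[] := node i k.+1 (leqW ik).
  + by rewrite ltr_pM2r ?invr_gt0// ltr_nat.
  + by have /andP[] := node i.+1 k.+1 ik.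
  have -> : k.+2%:R * (F i.+1 j - F i j) = g1 c (j%:R / k.+2%:R).
    by rewrite /F E nodeS mulrCA divff ?mulr1.
  have [c01 ci] := near_node c i ik ic.
  by apply: unit_modulus_sample => //; exact: node.
- rewrite [X in X - _](_ : _ = bernstein2 k.+2 k.+1
      (fun i j => k.+2%:R * (F i j.+1 - F i j)) t x); last first.
    by rewrite /bernstein2; congr horner; congr bernstein; apply/funext => i;
      rewrite deriv_bernstein.
  apply: le_trans (err C2 k.+1 k C20 _ _ _); rewrite ?leqnSn//; last by rewrite /D; lra.
  apply: bernstein2_error; rewrite ?mulr_ge0// => i j ik jk.
  have [||||c jc E] := H2 (i%:R / k.+2%:R) (j%:R / k.+2%:R) (j.+1%:R / k.+2%:R).
  + exact: node.
  + by have /andP[] := node j k.+1 (leqW jk).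
  + by rewrite ltr_pM2r ?invr_gt0// ltr_nat.
  + by have /andP[] := node j.+1 k.+1 jk.
  have -> : k.+2%:R * (F i j.+1 - F i j) = g2 (i%:R / k.+2%:R) c.
    by rewrite /F E nodeS mulrCA divff ?mulr1.
  have [c01 cj] := near_node c j jk jc.
  by apply: unit_modulus_sample => //; exact: node.
Qed.

End Bernstein.

(** * Polynomial jets *)

Section PolynomialJets.
Context {R : realType}.
Variables (K : set (R * R)) (sigma dsigma : R -> R) (alpha beta gamma : R).
Hypothesis profile_Xn : forall k, poly_profile K sigma dsigma 'X^k.

Notation u z := (alpha * z.1).
Notation v z := (beta * z.2 + gamma).
Notation jet_span := (jet_span K sigma dsigma).

Definition pjet (p q : {poly R}) : option bool * (R * R) -> R :=
  jet (fun z => p.[u z] * q.[v z])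
      (fun z => alpha * (p^`().[u z] * q.[v z]))
      (fun z => beta * (p.[u z] * q^`().[v z])).

(* The jet of [(a u + v)^k] is a polynomial in [a] whose coefficients are multiples
   of the jets of the monomials of degree [k]. *)
Lemma jet_span_monomial i j : jet_span (pjet 'X^i 'X^j).
Proof.
pose k := (i + j)%N.
pose V m x := 'C(k, m)%:R * pjet 'X^m 'X^(k - m) x.
have SV a : jet_span (fun x => \sum_(m < k.+1) a ^+ m * V m x).
  apply: eq_closed_span (profile_Xn k (a * alpha, beta, gamma)) => x _.
  have argE (z : R * R) : ridge_arg (a * alpha, beta, gamma) z = a * u z + v z.
    by rewrite /ridge_arg/=; ring.
  (* The binomial theorem is stated as an identity of polynomials in one variable, so that formal
     differentiation also yields the derivative components; [vE] does this for the second
     variable. *)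
  have uE (U W : R) : (a *: 'X + W%:P) ^+ k =
      \sum_(m < k.+1) (a ^+ m * 'C(k, m)%:R * W ^+ (k - m)) *: 'X^m.
    rewrite addrC exprDn; apply: eq_bigr => m _.
    rewrite exprZn -polyC_exp -mul_polyC mulrCA -mulr_natr -mul_polyC.
    by rewrite !polyCM polyC_natr; ring.
  have vE (U W : R) : ('X + (a * U)%:P) ^+ k =
      \sum_(m < k.+1) (a ^+ m * 'C(k, m)%:R * U ^+ m) *: 'X^(k - m).
    rewrite exprDn; apply: eq_bigr => m _.
    rewrite -polyC_exp exprMn -mulr_natr -mul_polyC.
    by rewrite !polyCM polyC_natr; ring.
  have hE := (hornerD, hornerX, hornerC, hornerZ, hornerMn, horner_exp, horner_sum).
  case: x => -[[|]|] z; rewrite /ridge/jet/V/pjet/jet/= argE;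
    move: (u z) (v z) => U W.
  - have /(congr1 (fun p : {poly R} => p^`().[W])) := vE U W.
    rewrite deriv_exp derivD derivX derivC addr0 mul1r raddf_sum !hE addrC.
    rewrite derivXn hornerMn hornerXn => ->.
    rewrite mulr_sumr; apply: eq_bigr => m _.
    by rewrite /= derivZ hornerZ hornerXn; ring.
  - have /(congr1 (fun p : {poly R} => p^`().[U])) := uE U W.
    rewrite deriv_exp derivD derivZ derivX derivC addr0 raddf_sum -scalerAl mul1r !hE.
    rewrite derivXn hornerMn hornerXn => E.
    rewrite (mulrC a) -mulrA mulrnAr E mulr_sumr; apply: eq_bigr => m _.
    by rewrite /= derivZ hornerZ hornerXn; ring.
  - have /(congr1 (fun p : {poly R} => p.[U])) := uE U W.
    rewrite !hE => ->; apply: eq_bigr => m _.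
    by rewrite hornerZ !hornerXn; ring.
have ik : (i < k.+1)%N by rewrite ltnS leq_addr.
have C0 : 'C(k, i)%:R != 0 :> R by rewrite pnatr_eq0 -lt0n bin_gt0.
apply: eq_closed_span (closed_spanZ ('C(k, i)%:R)^-1 (closed_span_coef SV ik)) => x _.
by rewrite /V mulrA mulVf// mul1r addKn.
Qed.

Lemma jet_span_pjet p q : jet_span (pjet p q).
Proof.
have Sq i : jet_span (pjet 'X^i q).
  have := closed_span_sum (index_enum 'I_(size q)) (fun j => q`_j)
    (fun j => jet_span_monomial i j).
  apply: eq_closed_span => -[[[|]|] z] _; rewrite /pjet/jet/=.
  - rewrite [in RHS]horner_deriv_coef 2!mulr_sumr; apply: eq_bigr => j _; ring.
  - rewrite (horner_coef q) 2!mulr_sumr; apply: eq_bigr => j _.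
    by rewrite hornerXn; ring.
  - rewrite (horner_coef q) mulr_sumr; apply: eq_bigr => j _.
    by rewrite !hornerXn; ring.
have := closed_span_sum (index_enum 'I_(size p)) (fun i => p`_i) (fun i => Sq i).
apply: eq_closed_span => -[[[|]|] z] _; rewrite /pjet/jet/=.
- rewrite (horner_coef p) mulr_suml mulr_sumr; apply: eq_bigr => j _.
  by rewrite hornerXn; ring.
- by rewrite [in RHS]horner_deriv_coef mulr_suml mulr_sumr; apply: eq_bigr => j _; ring.
- rewrite (horner_coef p) mulr_suml; apply: eq_bigr => j _.
  by rewrite hornerXn; ring.
Qed.

Lemma jet_span_bernstein n (phi : nat -> {poly R}) : jet_span (jet
  (fun z => (bernstein n (fun i => (phi i).[v z])).[u z])
  (fun z => alpha * (bernstein n (fun i => (phi i).[v z]))^`().[u z])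
  (fun z => beta * (bernstein n (fun i => (phi i)^`().[v z])).[u z])).
Proof.
(* The prefactor [p] absorbs the factors ['X] and [1 - 'X] of the recursion, which makes the
   induction on [n] close. *)
suff H p : jet_span (jet
    (fun z => (p * bernstein n (fun i => (phi i).[v z])).[u z])
    (fun z => alpha * (p * bernstein n (fun i => (phi i).[v z]))^`().[u z])
    (fun z => beta * (p * bernstein n (fun i => (phi i)^`().[v z])).[u z])).
  by apply: eq_closed_span (H 1) => -[[[|]|] z] _; rewrite /jet/= mul1r.
elim: n phi p => [|n IH] phi p.
  apply: eq_closed_span (jet_span_pjet p (phi 0%N)) => -[[[|]|] z] _;
    rewrite /pjet/jet/=.
  - by rewrite hornerM hornerC.
  - by rewrite derivM derivC mulr0 addr0 hornerM hornerC.
  - by rewrite hornerM hornerC.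
apply: eq_closed_span (closed_spanD (IH (fun i => phi i.+1) (p * 'X))
  (IH phi (p * (1 - 'X)))) => -[[[|]|] z] _; rewrite /jet/=.
- by rewrite -mulrDr -hornerD -!mulrA -mulrDr.
- by rewrite -mulrDr -hornerD -derivD -!mulrA -mulrDr.
- by rewrite -hornerD -!mulrA -mulrDr.
Qed.

End PolynomialJets.

(** * Calculus on the rectangle *)

Section Rectangle.
Context {R : realType}.

(** Since [a < b], admissible increments accumulate at [0] even at the endpoints; the restricted
    filter is proper and its limit unique, hence equal to the two-sided derivative. *)
Lemma derive_within_itv (a b : R) (g : R -> R) (x d : R) : a < b ->
  a <= x <= b -> is_derive x 1 g d -> derive_within `[a, b] g x = d.
Proof.
move=> ab /andP[ax xb] dg.
have PF : ProperFilter (within [set h | `[a, b]%classic (x + h)] 0^').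
  apply: Build_ProperFilter_ex => P /nbhs_ballP[r /= r0 rP].
  (* Increments go to the right, except at [x = b], where they go to the left. *)
  have [xltb|bx] := ltP x b.
    pose h := Num.min (r / 2) (b - x).
    have h0 : 0 < h by rewrite lt_min divr_gt0//= subr_gt0.
    have hb : h <= b - x by rewrite ge_min lexx orbT.
    have hr : h <= r / 2 by rewrite ge_min lexx.
    exists h; apply: rP; rewrite ?gt_eqF//=.
      by rewrite /ball/= sub0r normrN gtr0_norm//; lra.
    by rewrite in_itv/=; lra.
  pose h := Num.min (r / 2) (x - a).
  have h0 : 0 < h by rewrite lt_min divr_gt0//= subr_gt0; lra.
  have hb : h <= x - a by rewrite ge_min lexx orbT.
  have hr : h <= r / 2 by rewrite ge_min lexx.
  exists (- h); apply: rP; rewrite ?oppr_eq0 ?gt_eqF//=.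
    by rewrite /ball/= sub0r opprK gtr0_norm//; lra.
  by rewrite in_itv/=; lra.
have [/cvg_ex[l /= gl] dl] := dg.
have <- : l = d by rewrite -dl; apply/esym/cvg_lim.
apply: cvg_lim => //; apply: cvg_within_filter.
apply: cvg_trans gl; apply: near_eq_cvg; near=> h.
by rewrite [h *: 1]mulr1 (addrC x).
Unshelve. all: by end_near. Qed.

(** At an interior point small increments are all admissible, so the restricted filter is the full
    punctured one. *)
Lemma is_derive_within_itv (a b : R) (g : R -> R) (x : R) : a < x < b ->
  derivable_within `[a, b] g x -> is_derive x 1 g (derive_within `[a, b] g x).
Proof.
move=> /andP[ax xb] dg.
have E : within [set h | `[a, b]%classic (x + h)] 0^' = 0^'.
  apply/seteqP; split => P; last by apply: cvg_within.
  move=> H; near=> h.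
  have : [set h | `[a, b]%classic (x + h)] h -> P h by near: h; exact: H.
  apply => /=; rewrite in_itv/=.
  have : `|h| < Num.min (x - a) (b - x).
    near: h; apply: dnbhs0_lt; rewrite lt_min !subr_gt0 ax//.
  by rewrite lt_min !ltr_norml => /andP[/andP[? ?] /andP[? ?]]; lra.
have Q : (fun h : R => h^-1 *: (g (h *: 1 + x) - g x)) =
    (fun h => h^-1 * (g (x + h) - g x)).
  by apply/funext => h; rewrite [h *: 1]mulr1 (addrC x).
apply: DeriveDef; first by rewrite /derivable Q -E.
by rewrite /derive Q /derive_within E.
Unshelve. all: by end_near. Qed.

Lemma derive_within_MVT (a b : R) (g : R -> R) (s t : R) :
  {within `[a, b], continuous g} ->
  (forall x, a <= x <= b -> derivable_within `[a, b] g x) ->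
  a <= s -> s < t -> t <= b ->
  exists2 c, s <= c <= t & g t - g s = derive_within `[a, b] g c * (t - s).
Proof.
move=> cg dg as_ st tb.
have [|| c cst ->] := @MVT R g (derive_within `[a, b] g) s t st.
- move=> x; rewrite in_itv/= => /andP[sx xt].
  by apply: is_derive_within_itv; [lra|apply: dg; lra].
- apply: continuous_subspaceW cg => x /=; rewrite !in_itv/= => /andP[sx xt].
  by lra.
by exists c => //; rewrite !(itvP cst).
Qed.

Variables (T xL xR : R).
Hypotheses (T_gt0 : 0 < T) (xL_lt_xR : xL < xR).
Notation K := (rect T xL xR).
Notation L := (xR - xL).

Lemma rectP (z : R * R) : K z <-> (0 <= z.1 <= T) /\ (xL <= z.2 <= xR).
Proof. by rewrite /rect /= !in_itv. Qed.

Lemma rect_compact : compact K.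
Proof. by apply: compact_setX; exact: segment_compact. Qed.

Lemma rect_bounded : exists B, forall z, K z -> `|z.1| <= B /\ `|z.2| <= B.
Proof.
exists (`|T| + `|xL| + `|xR|) => z /rectP[/andP[z1 z2] /andP[z3 z4]].
have := ler_norm T; have := ler_norm xR; have := ler_norm (- xL); rewrite normrN.
have := normr_ge0 T; have := normr_ge0 xR; have := normr_ge0 xL.
by rewrite !ler_norml => *; split; apply/andP; split; lra.
Qed.

Lemma continuous_slice1 (f : R * R -> R) x : {within K, continuous f} ->
  xL <= x <= xR -> {within `[0, T], continuous (fun s => f (s, x))}.
Proof.
move=> /subspace_continuousP cf xx; apply/subspace_continuousP => s s0.
have Ksx : K (s, x) by split => //=; rewrite in_itv.
apply/cvgrPdist_le => eps e0.
have := cf _ Ksx; move/cvgrPdist_le => /(_ _ e0) /nbhs_ballP[r /= r0 H].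
apply/nbhs_ballP; exists r => //= y ry y0; apply: (H (y, x)).
  by split => //=; exact: ballxx.
by split => //=; rewrite in_itv.
Qed.

Lemma continuous_slice2 (f : R * R -> R) t : {within K, continuous f} ->
  0 <= t <= T -> {within `[xL, xR], continuous (fun y => f (t, y))}.
Proof.
move=> /subspace_continuousP cf tt; apply/subspace_continuousP => s s0.
have Ksx : K (t, s) by split => //=; rewrite in_itv.
apply/cvgrPdist_le => eps e0.
have := cf _ Ksx; move/cvgrPdist_le => /(_ _ e0) /nbhs_ballP[r /= r0 H].
apply/nbhs_ballP; exists r => //= y ry y0; apply: (H (t, y)).
  by split => //=; exact: ballxx.
by split => //=; rewrite in_itv.
Qed.

Lemma rect_scale s x : 0 <= s <= 1 -> 0 <= x <= 1 -> K (T * s, xL + L * x).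
Proof.
move=> /andP[s0 s1] /andP[x0 x1]; have L0 : 0 < L by rewrite subr_gt0.
have Lx0 : 0 <= L * x by rewrite mulr_ge0// ltW.
have Lx1 : L * x <= L by rewrite ler_piMr// ltW.
apply/rectP => /=; split; last by lra.
by rewrite mulr_ge0 ?ler_piMr// ltW.
Qed.

(** Close points are handled by uniform continuity. For points not [d]-close some coordinate differs
    by at least [d], so the bound [2 * M] is absorbed by the quadratic term with constant [D]. The
    factor [c] will be the side length from the chain rule. *)
Lemma unit_modulus_rect (f : R * R -> R) (c : R) : {within K, continuous f} ->
  unit_modulus (fun s x => c * f (T * s, xL + L * x)).
Proof.
move=> cf eps e0.
have c0 : 0 < `|c| + 1 by rewrite ltr_wpDl.
have [d d0 Hd] := Heine_Cantor rect_compact cf (divr_gt0 e0 c0).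
have [M M0 HM] := compact_continuous_bounded rect_compact cf.
pose D := `|c| * (2 * M) / d ^+ 2.
have D0 : 0 <= D by rewrite divr_ge0 ?exprn_ge0 ?(ltW d0)// !mulr_ge0// ltW.
have L0 : 0 < L by rewrite subr_gt0.
exists (D * (T ^+ 2 + L ^+ 2)).
  by rewrite mulr_ge0// addr_ge0// sqr_ge0.
move=> s t x y s01 t01 x01 y01.
have Kp := rect_scale s01 x01; have Kq := rect_scale t01 y01.
rewrite -mulrBr normrM.
have [near_pq|far_pq] := pselect (ball (T * s, xL + L * x) d (T * t, xL + L * y)).
  rewrite ler_wpDr//.
    apply: mulr_ge0; last by apply: addr_ge0; exact: sqr_ge0.
    by apply: mulr_ge0 => //; apply: addr_ge0; exact: sqr_ge0.
  rewrite (le_trans (ler_wpM2l (normr_ge0 _) (Hd _ _ Kp Kq near_pq)))//.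
  by rewrite mulrCA ger_pMr// ler_pdivrMr// mul1r lerDl.
have dd : d ^+ 2 <= (T ^+ 2 + L ^+ 2) * ((s - t) ^+ 2 + (x - y) ^+ 2).
  have sq (r : R) : ~ `|r| < d -> d ^+ 2 <= r ^+ 2.
    move=> /negP; rewrite -leNgt => dr; rewrite -[r ^+ 2]real_normK ?num_real//.
    by rewrite lerXn2r// nnegrE ltW.
  have [H|/sq H] := pselect (`|T * s - T * t| < d).
    have /sq H2 : ~ `|xL + L * x - (xL + L * y)| < d by move=> H2; apply: far_pq.
    apply: le_trans H2 _.
    have -> : xL + L * x - (xL + L * y) = L * (x - y) by ring.
    have := mulr_ge0 (sqr_ge0 T) (sqr_ge0 (s - t)).
    have := mulr_ge0 (sqr_ge0 T) (sqr_ge0 (x - y)).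
    have := mulr_ge0 (sqr_ge0 L) (sqr_ge0 (s - t)).
    by rewrite exprMn mulrDl !mulrDr => *; lra.
  apply: le_trans H _.
  have -> : T * s - T * t = T * (s - t) by ring.
  have := mulr_ge0 (sqr_ge0 T) (sqr_ge0 (x - y)).
  have := mulr_ge0 (sqr_ge0 L) (sqr_ge0 (s - t)).
  have := mulr_ge0 (sqr_ge0 L) (sqr_ge0 (x - y)).
  by rewrite exprMn mulrDl !mulrDr => *; lra.
apply: (@le_trans _ _ (`|c| * (2 * M))).
  rewrite ler_wpM2l// (le_trans (ler_normB _ _))//.
  by have := HM _ Kp; have := HM _ Kq; lra.
rewrite ler_wpDl ?(ltW e0)// -mulrA /D [leRHS]mulrAC ler_pdivlMr ?exprn_gt0//.
by rewrite ler_wpM2l// !mulr_ge0// ltW.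
Qed.

(** Rescales to the unit square, where partial derivatives gain factors [T] and [L], applies
    Bernstein approximation in C^1, and scales back. *)
Lemma jet_span_C1 (sigma dsigma : R -> R) (f : R * R -> R) :
  (forall k, poly_profile K sigma dsigma 'X^k) -> Cn_rect 1 T xL xR f ->
  jet_span K sigma dsigma (jet f (pdt T f) (pdx xL xR f)).
Proof.
move=> PX [cf [df [cft _] [cfx _]]].
have L0 : 0 < L by rewrite subr_gt0.
(* With slopes [T^-1] and [L^-1], this offset maps the rectangle onto the unit square. *)
pose gamma := - xL / L.
apply: closed_span_lim => eps e0.
have c0 : 0 < 1 + T^-1 + L^-1 by rewrite !addr_gt0// invr_gt0.
have scale (s x : R) : 0 <= s <= 1 -> 0 <= x <= 1 -> xL <= xL + L * x <= xR /\ 0 <= T * s <= T.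
  by move=> s01 x01; have /rectP[] := rect_scale s01 x01.
have [||n [F HF]] := @bernstein2_C1 R (fun s x => 1 * f (T * s, xL + L * x))
  (fun s x => T * pdt T f (T * s, xL + L * x))
  (fun s x => L * pdx xL xR f (T * s, xL + L * x))
  (unit_modulus_rect _ cf) (unit_modulus_rect _ cft) (unit_modulus_rect _ cfx)
  _ _ _ (divr_gt0 e0 c0).
- move=> x s t x01 s0 st t1.
  have [xx _] := scale t x ltac:(lra) x01.
  have [||||c cst E] := derive_within_MVT (s := T * s) (t := T * t)
    (continuous_slice1 cf xx).
  + move=> y yT; have Ky : K (y, xL + L * x) by apply/rectP.
    by have [] := df _ Ky.
  + by rewrite mulr_ge0// ltW.
  + by rewrite ltr_pM2l.
  + by rewrite ler_piMr// ltW.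
  exists (c / T); first by rewrite ler_pdivlMr// ler_pdivrMr// ![_ * T]mulrC.
  rewrite !mul1r E /pdt/= [T * (c / T)]mulrCA divff ?mulr1 ?gt_eqF//.
  by ring.
- move=> t x y t01 x0 xy y1.
  have [_ tt] := scale t x t01 ltac:(lra).
  have [||||c cst E] := derive_within_MVT (s := xL + L * x) (t := xL + L * y)
    (continuous_slice2 cf tt).
  + move=> z zT; have Kz : K (T * t, z) by apply/rectP.
    by have [] := df _ Kz.
  + by rewrite lerDl mulr_ge0// ltW.
  + by rewrite ltrD2l ltr_pM2l.
  + by rewrite -lerBrDl ler_piMr// ltW.
  exists ((c - xL) / L).
    by rewrite ler_pdivlMr// ler_pdivrMr// ![_ * L]mulrC lerBrDl lerBlDl.
  rewrite !mul1r E /pdx/= [L * ((c - xL) / L)]mulrCA divff ?mulr1 ?gt_eqF//.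
  by rewrite [xL + (c - xL)]addrC subrK; ring.
pose phi i := bernstein n (F i).
exists (jet
  (fun z => (bernstein n (fun i => (phi i).[L^-1 * z.2 + gamma])).[T^-1 * z.1])
  (fun z => T^-1 * (bernstein n (fun i => (phi i).[L^-1 * z.2 + gamma]))^`().[T^-1 * z.1])
  (fun z => L^-1 * (bernstein n (fun i => (phi i)^`().[L^-1 * z.2 + gamma])).[T^-1 * z.1])).
  exact: jet_span_bernstein.
move=> [w z] /= /rectP[zT zL].
have T0' : T != 0 by rewrite gt_eqF.
have L0' : xR - xL != 0 by rewrite gt_eqF.
have s01 : 0 <= T^-1 * z.1 <= 1.
  by rewrite ler_pdivrMl// mulr1 mulr_ge0 ?invr_ge0 ?(ltW T_gt0)//; lra.
have x01 : 0 <= L^-1 * z.2 + gamma <= 1.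
  have -> : L^-1 * z.2 + gamma = (z.2 - xL) / L by rewrite /gamma; ring.
  by rewrite ler_pdivrMr// mul1r divr_ge0 ?(ltW L0)//; lra.
have [] := HF _ _ s01 x01.
have -> : (T * (T^-1 * z.1), xL + L * (L^-1 * z.2 + gamma)) = z.
  by rewrite [RHS]surjective_pairing; congr pair; rewrite /gamma; field.
have Teps : T^-1 * (eps / (1 + T^-1 + L^-1)) <= eps.
  rewrite mulrCA ger_pMr// ler_pdivrMr// mul1r.
  by rewrite addrAC lerDr addr_ge0// invr_ge0 ltW.
have Leps : L^-1 * (eps / (1 + T^-1 + L^-1)) <= eps.
  rewrite mulrCA ger_pMr// ler_pdivrMr// mul1r.
  by rewrite lerDr addr_ge0// invr_ge0 ltW.
rewrite mul1r => H1 H2 H3; case: w => [[|]|]; rewrite /jet/=.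
- have C0 : 0 < L^-1 by rewrite invr_gt0.
  apply: le_trans Leps; apply: le_trans (ler_wpM2l (ltW C0) H3).
  by rewrite -[X in _ <= X * _](gtr0_norm C0) -normrM mulrBr mulKf.
- have C0 : 0 < T^-1 by rewrite invr_gt0.
  apply: le_trans Teps; apply: le_trans (ler_wpM2l (ltW C0) H2).
  by rewrite -[X in _ <= X * _](gtr0_norm C0) -normrM mulrBr mulKf.
- apply: le_trans H1 _; rewrite ger_pMr// invf_le1//.
  by rewrite -addrA lerDl addr_ge0// invr_ge0 ltW.
Qed.

End Rectangle.

(** * Networks and the loss *)

Section Networks.
Context {R : realType}.

(** A node of weight zero is prepended so that the number of nodes is positive even for the empty
    list; all outer biases are zero. *)
Definition list_net (l : seq (R * (R * R * R))) : nn_params R :=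
  let l' := (0, (0, 0, 0)) :: l in
  let p (i : 'I_(size l')) := nth (0, (0, 0, 0)) l' i in
  @NNParams R (size l') isT
    (\matrix_(i, j) if j == 0 then (p i).2.1.1 else (p i).2.1.2)
    (\col_i (p i).2.2) (\row_i (p i).1) 0.

Lemma nn_list_net (sigma dsigma : R -> R) l z :
  nn sigma (list_net l) z = lincomb (ridge sigma dsigma) l (None, z).
Proof.
rewrite /nn /lincomb /list_net; set l' := _ :: l; cbn [nn_nodes nn_w1 nn_w2 nn_b1 nn_b2].
rewrite (eq_bigr (fun i : 'I_(size l') =>
  (nth (0, (0, 0, 0)) l' i).1 * ridge sigma dsigma (nth (0, (0, 0, 0)) l' i).2 (None, z))).
  rewrite -(big_mkord xpredT (fun i => (nth (0, (0, 0, 0)) l' i).1 *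
    ridge sigma dsigma (nth (0, (0, 0, 0)) l' i).2 (None, z))).
  by rewrite -(big_nth _ xpredT (fun p => p.1 * ridge sigma dsigma p.2 (None, z)))
    big_cons mul0r add0r.
by move=> i _; rewrite !mxE /= addr0.
Qed.

Lemma has_derivative_affine (w a b : R) (s ds : R -> R) : has_derivative s ds ->
  has_derivative (fun y => w * s (a * y + b)) (fun y => w * (a * ds (a * y + b))).
Proof.
move=> dsE y; pose q : {poly R} := a *: 'X + b%:P.
have qE x : q.[x] = a * x + b by rewrite !hornerE.
have dq : is_derive y 1 (horner q) a.
  have := has_derivative_poly q y.
  by rewrite derivD derivZ derivX derivC addr0 hornerZ hornerC mulr1.
have ds' : is_derive (horner q y) 1 s (ds (a * y + b)) by rewrite -qE; exact: dsE.
have := is_deriveZ w (is_derive1_comp ds' dq).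
rewrite (mulrC _ a); congr (is_derive _ _ _ _).
by apply/funext => x; rewrite /= -qE.
Qed.

Lemma has_derivative_sum (J : Type) (r : seq J) (f df : J -> R -> R) :
  (forall j, has_derivative (f j) (df j)) ->
  has_derivative (fun y => \sum_(j <- r) f j y) (fun y => \sum_(j <- r) df j y).
Proof.
move=> fE; elim: r => [|j r IH] y.
  under eq_fun do rewrite big_nil.
  by rewrite big_nil; exact: is_derive_cst.
under eq_fun do rewrite big_cons.
rewrite big_cons; have d1 := fE j y; have d2 := IH y.
exact: is_deriveD.
Qed.

Lemma jet_list_net (sigma dsigma : R -> R) (T xL xR : R) l z :
  has_derivative sigma dsigma -> 0 < T -> xL < xR -> rect T xL xR z ->
  pdt T (nn sigma (list_net l)) z = lincomb (ridge sigma dsigma) l (Some false, z) /\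
  pdx xL xR (nn sigma (list_net l)) z = lincomb (ridge sigma dsigma) l (Some true, z).
Proof.
move=> dsE T0 LR /rectP[zT zL].
split; apply: derive_within_itv => //.
  have := @has_derivative_sum _ l
    (fun p y => p.1 * sigma (p.2.1.1 * y + (p.2.1.2 * z.2 + p.2.2)))
    (fun p y => p.1 * (p.2.1.1 * dsigma (p.2.1.1 * y + (p.2.1.2 * z.2 + p.2.2))))
    (fun p => has_derivative_affine _ _ _ dsE) z.1.
  congr is_derive; last first.
    by apply: eq_bigr => p _; rewrite /ridge/jet/ridge_arg/= addrA.
  apply/funext => y; rewrite (nn_list_net _ dsigma).
  by apply: eq_bigr => p _; rewrite /ridge/jet/ridge_arg/= addrA.
have := @has_derivative_sum _ l
  (fun p y => p.1 * sigma (p.2.1.2 * y + (p.2.1.1 * z.1 + p.2.2)))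
  (fun p y => p.1 * (p.2.1.2 * dsigma (p.2.1.2 * y + (p.2.1.1 * z.1 + p.2.2))))
  (fun p => has_derivative_affine _ _ _ dsE) z.2.
congr is_derive; last first.
  by apply: eq_bigr => p _; rewrite /ridge/jet/ridge_arg/= addrCA addrA.
apply/funext => y; rewrite (nn_list_net _ dsigma).
by apply: eq_bigr => p _; rewrite /ridge/jet/ridge_arg/= addrCA addrA.
Qed.

(** The jet of a network is the linear combination of the jets of its ridge functions, so membership
    in [jet_span] is C^1 approximation by a single network. *)
Lemma network_C1_density (sigma : R -> R) (T xL xR : R) (f : R * R -> R) :
  C1_real sigma -> ~ is_polynomial sigma -> 0 < T -> xL < xR ->
  Cn_rect 1 T xL xR f -> forall eps, 0 < eps ->
  exists q, forall z, rect T xL xR z ->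
    [/\ `|nn sigma q z - f z| <= eps,
        `|pdt T (nn sigma q) z - pdt T f z| <= eps &
        `|pdx xL xR (nn sigma q) z - pdx xL xR f z| <= eps].
Proof.
move=> [dsigma csigma] npoly T0 LR fC1 eps e0.
have dsE : has_derivative sigma (derive1 sigma).
  by move=> x; rewrite derive1E; exact: derivableP.
have [B KB] := rect_bounded T xL xR.
have PX := poly_profile_Xn KB dsE csigma npoly.
have [l lf] := jet_span_C1 T0 LR PX fC1 e0.
exists (list_net l) => z Kz.
have [-> ->] := jet_list_net l dsE T0 LR Kz.
rewrite (nn_list_net _ (derive1 sigma)).
split; rewrite distrC.
- exact: (lf (None, z)).
- exact: (lf (Some false, z)).
- exact: (lf (Some true, z)).
Qed.

End Networks.

(** * The loss is controlled by the C^1 distance to the solution *)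

Section LossBound.
Context {R : realType}.
Local Notation mu := (@lebesgue_measure R).

Lemma integral_itv_le (a b c : R) (f : R -> \bar R) : a <= b -> 0 <= c ->
  (forall x, a <= x <= b -> (0 <= f x)%E) ->
  (forall x, a <= x <= b -> (f x <= c%:E)%E) ->
  (\int[mu]_(x in `[a, b]) f x <= (c * (b - a))%:E)%E.
Proof.
move=> ab c0 f0 fc.
apply: (@le_trans _ _ (\int[mu]_(x in `[a, b]) c%:E)%E).
  by apply: le_integral_of_le => x /=; rewrite in_itv/=; [exact: f0|exact: fc].
rewrite integral_cst//= lebesgue_measure_itv/= lte_fin.
case: ifPn => [_|]; first by rewrite -EFinD -EFinM.
by rewrite -leNgt mule0 lee_fin => ?; rewrite mulr_ge0// subr_ge0.
Qed.

Lemma sqr_norm_le (r c : R) : `|r| <= c -> `|r| ^+ 2 <= c ^+ 2.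
Proof. by move=> rc; rewrite lerXn2r// nnegrE (le_trans _ rc). Qed.

Lemma loss_stage2_ge0 (T xL xR lambda1 lambda2 : R) (Phi G m0 m1 p0 p1 : R * R -> R) :
  0 <= lambda1 -> 0 <= lambda2 ->
  (0 <= loss_stage2 T xL xR lambda1 lambda2 Phi G m0 m1 p0 p1)%E.
Proof.
move=> l1 l2.
have sq (r : R) : (0 <= (`|r| ^+ 2)%:E)%E by rewrite lee_fin exprn_ge0.
rewrite /loss_stage2 /loss_GE /loss_BC /loss_IC.
apply: adde_ge0; [apply: adde_ge0|].
- by apply: adde_ge0; do 2 (apply: integral_ge0 => ? _).
- by apply: mule_ge0; rewrite ?lee_fin//; apply: adde_ge0; apply: integral_ge0.
- by apply: mule_ge0; rewrite ?lee_fin//; apply: adde_ge0; apply: integral_ge0.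
Qed.

(** Subtracting the identities satisfied by [(m0, m1)] bounds the residuals by [2 * eps] (first
    equation, boundary), [(M + 1) * eps] (second equation) and [eps] (initial data); [(M + 2) * eps]
    covers all of them. *)
Lemma loss_stage2_le (T xL xR lambda1 lambda2 M eps : R)
    (Phi G m0 m1 p0 p1 : R * R -> R) :
  0 < T -> xL < xR -> 0 <= lambda1 -> 0 <= lambda2 -> 0 <= M -> 0 <= eps ->
  (forall z, rect T xL xR z -> `|pdx xL xR Phi z| <= M) ->
  moment_system T xL xR Phi G m0 m1 ->
  periodic_bc T xL xR m0 -> periodic_bc T xL xR m1 ->
  (forall z, rect T xL xR z -> [/\ `|p0 z - m0 z| <= eps,
     `|pdt T p0 z - pdt T m0 z| <= eps & `|pdx xL xR p0 z - pdx xL xR m0 z| <= eps]) ->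
  (forall z, rect T xL xR z -> [/\ `|p1 z - m1 z| <= eps,
     `|pdt T p1 z - pdt T m1 z| <= eps & `|pdx xL xR p1 z - pdx xL xR m1 z| <= eps]) ->
  (loss_stage2 T xL xR lambda1 lambda2 Phi G m0 m1 p0 p1 <=
    (((M + 2) * eps) ^+ 2 * (2 * ((xR - xL) * T + lambda1 * T + lambda2 * (xR - xL))))%:E)%E.
Proof.
move=> T0 LR l1 l2 M0 e0 PhiM sys per0 per1 H0 H1.
pose c := ((M + 2) * eps) ^+ 2.
have c0 : 0 <= c by exact: sqr_ge0.
have L0 : 0 <= xR - xL by rewrite subr_ge0 ltW.
have T0' := ltW T0; have LR' := ltW LR.
have inK t x : 0 <= t <= T -> xL <= x <= xR -> rect T xL xR (t, x).
  by move=> tT xx; apply/rectP.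
have sq (r : R) : (0 <= (`|r| ^+ 2)%:E)%E by rewrite lee_fin exprn_ge0.
have sqc (r : R) : `|r| <= (M + 2) * eps -> ((`|r| ^+ 2)%:E <= c%:E)%E.
  by move=> rc; rewrite lee_fin; exact: sqr_norm_le.
have tT0 : 0 <= T <= T by rewrite T0' lexx.
have xLL : xL <= xL <= xR by rewrite lexx.
have xRR : xL <= xR <= xR by rewrite lexx LR'.
have t0T : 0 <= (0 : R) <= T by rewrite lexx.
have Me : 0 <= M * eps by rewrite mulr_ge0.
have GE (r : R * R -> R) : (forall z, rect T xL xR z -> `|r z| <= (M + 2) * eps) ->
    (\int[mu]_(t in `[0%R, T]) \int[mu]_(x in `[xL, xR]) (`|r (t, x)| ^+ 2)%:E
      <= (c * (xR - xL) * T)%:E)%E.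
  move=> rc; rewrite -[X in _ * X](subr0 T).
  apply: integral_itv_le => //; first by rewrite mulr_ge0.
    by move=> t _; apply: integral_ge0.
  move=> t tT; apply: integral_itv_le => // x xx.
  by apply: sqc; apply: rc; exact: inK.
have BC (m p : R * R -> R) : periodic_bc T xL xR m ->
    (forall z, rect T xL xR z -> `|p z - m z| <= eps) ->
    (\int[mu]_(s in `[0%R, T]) (`|p (s, xL) - p (s, xR)| ^+ 2)%:E <= (c * T)%:E)%E.
  move=> per pm; rewrite -[X in _ * X](subr0 T).
  apply: integral_itv_le => // s sT; apply: sqc.
  have -> : p (s, xL) - p (s, xR) = (p (s, xL) - m (s, xL)) - (p (s, xR) - m (s, xR)).
    by rewrite per ?in_itv//; ring.
  rewrite (le_trans (ler_normB _ _))//.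
  by have := pm _ (inK _ _ sT xLL); have := pm _ (inK _ _ sT xRR); lra.
have IC (m p : R * R -> R) : (forall z, rect T xL xR z -> `|p z - m z| <= eps) ->
    (\int[mu]_(x in `[xL, xR]) (`|p (0, x) - m (0, x)| ^+ 2)%:E
      <= (c * (xR - xL))%:E)%E.
  move=> pm; apply: integral_itv_le => // x xx; apply: sqc.
  by have := pm _ (inK _ _ t0T xx); lra.
have -> : c * (2 * ((xR - xL) * T + lambda1 * T + lambda2 * (xR - xL))) =
   (c * (xR - xL) * T + c * (xR - xL) * T) + lambda1 * (c * T + c * T)
   + lambda2 * (c * (xR - xL) + c * (xR - xL)) by ring.
rewrite 2!EFinD 2!EFinM 3![in leRHS]EFinD.
apply: leeD; first apply: leeD.
- apply: leeD; [apply: (GE (fun z => pdt T p0 z + pdx xL xR p1 z)) |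
    apply: (GE (fun z => pdt T p1 z + G z + p0 z * pdx xL xR Phi z))] => z Kz.
    have [sys1 _] := sys _ Kz; have [_ h1 _] := H0 _ Kz; have [_ _ h2] := H1 _ Kz.
    have -> : pdt T p0 z + pdx xL xR p1 z = (pdt T p0 z - pdt T m0 z)
        + (pdx xL xR p1 z - pdx xL xR m1 z) by lra.
    by rewrite (le_trans (ler_normD _ _))//; lra.
  have [_ sys2] := sys _ Kz; have [h1 _ _] := H0 _ Kz; have [_ h2 _] := H1 _ Kz.
  (* The second equation for [(m0, m1)] eliminates [G], leaving approximation errors only. *)
  have -> : pdt T p1 z + G z + p0 z * pdx xL xR Phi z = (pdt T p1 z - pdt T m1 z)
      + (p0 z - m0 z) * pdx xL xR Phi z by rewrite mulrBl; lra.
  rewrite (le_trans (ler_normD _ _))// normrM.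
  have := ler_pM (normr_ge0 _) (normr_ge0 _) h1 (PhiM _ Kz).
  by lra.
- apply: lee_wpmul2l; first by rewrite lee_fin.
  by apply: leeD; [apply: (BC m0) => // z /H0[]|apply: (BC m1) => // z /H1[]].
- apply: lee_wpmul2l; first by rewrite lee_fin.
  by apply: leeD; apply: IC => z; [move/H0 => []|move/H1 => []].
Qed.

End LossBound.

(** * Convergence of the loss to zero *)

Theorem theorem1 (R : realType) (T xL xR lambda1 lambda2 : R)
    (Phi G m0 m1 : R * R -> R) (sigma : R -> R)
    (T_gt0 : 0 < T) (xL_lt_xR : xL < xR)
    (lambda1_gt0 : 0 < lambda1) (lambda2_gt0 : 0 < lambda2)
    (Phi_smooth : smooth_rect T xL xR Phi)
    (m0_C1 : Cn_rect 1 T xL xR m0) (m1_C1 : Cn_rect 1 T xL xR m1)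
    (m_system : moment_system T xL xR Phi G m0 m1)
    (m0_periodic : periodic_bc T xL xR m0)
    (m1_periodic : periodic_bc T xL xR m1)
    (sigma_C1 : C1_real sigma) (sigma_nonpoly : ~ is_polynomial sigma) :
  exists theta0 theta1 : nat -> nn_params R,
    loss_stage2 T xL xR lambda1 lambda2 Phi G m0 m1
      (nn sigma (theta0 j)) (nn sigma (theta1 j)) @[j --> \oo] --> 0%E.
Proof.
have eps_gt0 (j : nat) : 0 < j.+1%:R^-1 :> R by rewrite invr_gt0.
have [theta0 near_m0] := choice (fun j => network_C1_density sigma_C1 sigma_nonpoly
  T_gt0 xL_lt_xR m0_C1 (eps_gt0 j)).
have [theta1 near_m1] := choice (fun j => network_C1_density sigma_C1 sigma_nonpoly
  T_gt0 xL_lt_xR m1_C1 (eps_gt0 j)).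
exists theta0, theta1.
have [_ [_ _ [Phix_cont _]]] := Phi_smooth 1%N.
have K_compact : compact (rect T xL xR) by exact: rect_compact.
have [M M_gt0 PhiM] := compact_continuous_bounded K_compact Phix_cont.
(* With tolerance [1 / j.+1] the loss is at most [A / j.+1 ^ 2]. *)
pose A : R := (M + 2) ^+ 2 * (2 * ((xR - xL) * T + lambda1 * T + lambda2 * (xR - xL))).
have lim : ((A * (j.+1%:R^-1 * j.+1%:R^-1))%:E @[j --> \oo] --> 0%E)%classic.
  apply: cvg_EFin; first by near=> j.
  rewrite -[0]/(0 : R) -(mulr0 A); apply: cvgMr.
  by rewrite -(mulr0 0); apply: cvgM; exact: cvg_harmonic.
apply: squeeze_cvge (cvg_cst 0%E) lim; near=> j.
rewrite loss_stage2_ge0 ?(ltW lambda1_gt0) ?(ltW lambda2_gt0)//=.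
have -> : A * (j.+1%:R^-1 * j.+1%:R^-1) = ((M + 2) * j.+1%:R^-1) ^+ 2 *
    (2 * ((xR - xL) * T + lambda1 * T + lambda2 * (xR - xL))).
  by rewrite /A exprMn; ring.
by apply: (loss_stage2_le T_gt0 xL_lt_xR _ _ _ _ PhiM m_system m0_periodic m1_periodic
  (near_m0 j) (near_m1 j)); rewrite ltW.
Unshelve. all: by end_near. Qed.
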